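(* For every integer $d\ge 1$ there exist constants $c_d,c_d'>0$ depending only on $d$ such that the following holds. Let $n\ge 1$ and $r\ge d$ be integers and let $M$ be a real symmetric matrix indexed by $[n]^r\times[n]^r$. Assume that $M$ is maximally symmetric, positive semidefinite and $\mathrm{Tr}(M)=1$. Then there exists $\tau\in\mathcal C_d(\mathbb R^n)$ such that $$\|\mathrm{Tr}_{r-d}(M)-\tau\|_1\le\|\mathrm{Tr}_{r-d}(M)-\tau\|_{F1}\le c_d\,\frac{n^2}{r^2}\qquad\text{whenever } r\ge c_d' n.$$
   Context: $[n]=\{1,\dots,n\}$; for $\underline i,\underline j\in[n]^r$, $M_{\underline i,\underline j}$ denotes the corresponding entry of $M$. The matrix $M\in\mathbb R^{[n]^r\times[n]^r}$ is maximally symmetric if the $2r$-tensor $(M_{\underline i,\underline j})_{\underline i\,\underline j\in[n]^{2r}}$ is symmetric, i.e., its entries are invariant under all permutations of the $2r$ indices. The partial trace $\mathrm{Tr}_{r-d}(M)$ is the matrix indexed by $[n]^d\times[n]^d$ with entries $(\mathrm{Tr}_{r-d}(M))_{\underline i,\underline j}=\sum_{\underline k\in[n]^{r-d}}M_{\underline i\,\underline k,\underline j\,\underline k}$, where $\underline i\,\underline k$ denotes concatenation. $\mathcal C_d(\mathbb R^n)=\mathrm{conv}\{u^{\otimes d}(u^{\otimes d})^T: u\in\mathbb R^n,\|u\|_2=1\}$. $\|\cdot\|_1$ on matrices is the Schatten 1-norm (sum of absolute values of eigenvalues for a symmetric matrix). The norm $\|\cdot\|_{F1}$ on real maximally symmetric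 matrices $A$ indexed by $[n]^d\times[n]^d$ is defined as follows: let $R_{2d}$ be the space of real homogeneous polynomials of degree $2d$ in $x=(x_1,\dots,x_n)$, with norm $\|f\|_\infty=\max\{|f(x)|:x\in\mathbb R^n,\|x\|_2=1\}$. There is a unique linear functional $L:R_{2d}\to\mathbb R$ with $L(x^{\otimes d}(x^{\otimes d})^T)=A$ ($L$ applied entrywise), and $\|A\|_{F1}:=\max\{L(f):f\in R_{2d},\|f\|_\infty=1\}$. *)

(* Defs.v *)
From HB Require Import structures.
From mathcomp Require Import all_boot all_order all_fingroup all_algebra.
From mathcomp Require Import polyrcf.
From mathcomp.multinomials Require Import mpoly.
From mathcomp Require Import boolp classical_sets reals.

Set Implicit Arguments.
Unset Strict Implicit.
Unset Printing Implicit Defensive.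

Import Order.TTheory GRing.Theory Num.Theory.
Local Open Scope classical_set_scope.
Local Open Scope ring_scope.

(* Matrices indexed by [n]^d x [n]^d: the multi-indices are the d-tuples over
   'I_n, numbered by enum_rank / enum_val so that the theory of 'M applies. *)
Notation tdim n d := #|{: d.-tuple 'I_n}|.
Notation tensmx R n d := ('M[R]_(tdim n d)).

Section Entries.
Variables (T : Type) (n r : nat).
Implicit Type M : tensmx T n r.

Definition entry M (i j : r.-tuple 'I_n) : T := M (enum_rank i) (enum_rank j).

Definition max_symmetric M : Prop :=
  forall (s : 'S_(r + r)) (i j k l : r.-tuple 'I_n),
    cat_tuple k l = [tuple tnth (cat_tuple i j) (s x) | x < r + r] ->
    entry M k l = entry M i j.

End Entries.

Section Operations.
Variable (n : nat).

Definition partial_trace (R : nmodType) (d r : nat) (le_dr : (d <= r)%N)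
    (M : tensmx R n r) : tensmx R n d :=
  \matrix_(a, b) \sum_(k : (r - d).-tuple 'I_n)
    let idx (c : 'I_(tdim n d)) :=
      tcast (subnKC le_dr) (cat_tuple (enum_val c) k) in
    entry M (idx a) (idx b).

(* u^{(x)d}; the entries of u may be numbers or polynomial variables *)
Definition tens_pow (S : pzSemiRingType) (d : nat) (u : 'I_n -> S) :
    'cV[S]_(tdim n d) :=
  \col_a \prod_(x < d) u (tnth (enum_val a) x).

Definition tens_proj (S : pzSemiRingType) (d : nat) (u : 'I_n -> S) :
    tensmx S n d :=
  tens_pow d u *m (tens_pow d u)^T.

End Operations.

Section Real.
Variable R : realType.

Definition psdmx (m : nat) (M : 'M[R]_m) : Prop :=
  M^T = M /\ forall v : 'cV[R]_m, 0 <= (v^T *m M *m v) 0 0.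

Definition norm2 (n : nat) (u : 'rV[R]_n) : R := Num.sqrt (\sum_i u 0 i ^+ 2).

Definition unit_sphere (n : nat) : set 'rV[R]_n := [set u | norm2 u = 1].

Definition conv_hull (V : lmodType R) (A : set V) : set V :=
  [set v | exists (m : nat) (w : 'I_m -> R) (a : 'I_m -> V),
     [/\ forall i, 0 <= w i, \sum_i w i = 1, forall i, A (a i) &
         v = \sum_i w i *: a i]].

Definition Cd (n d : nat) : set (tensmx R n d) :=
  conv_hull [set tens_proj d (u 0) | u in @unit_sphere n].

(* Schatten 1-norm, for symmetric matrices only: the char_poly of such a matrix
   splits over R, so its real roots, counted with multiplicity, are all the
   eigenvalues. *)
Definition schatten1_sym (m : nat) (A : 'M[R]_m) : R :=
  \sum_(a <- rootsR (char_poly A)) `|a| *+ mup a (char_poly A).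

Lemma tens_proj_homog (n d : nat) (a b : 'I_(tdim n d)) :
  tens_proj d (fun i => 'X_i : {mpoly R[n]}) a b \is (2 * d).-homog.
Proof.
have Xh (c : 'I_(tdim n d)) :
    \prod_(x < d) ('X_(tnth (enum_val c) x) : {mpoly R[n]}) \is d.-homog.
  rewrite mprodXE dhomogX /= mdeg_sum.
  by rewrite (eq_bigr (fun=> 1%N)) ?sum1_card ?card_ord // => x _; rewrite mdeg1.
rewrite !mxE big_ord1 !mxE mul2n -addnn.
exact: dhomogM.
Qed.

(* The entries of x^{(x)d} (x^{(x)d})^T, as elements of R_{2d}. *)
Definition tens_monomial (n d : nat) (a b : 'I_(tdim n d)) :
    dhomog n R (2 * d) :=
  DHomog (tens_proj_homog a b).

(* sup is a maximum here: for 0 < n the sphere is a nonempty compact set. *)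
Definition sphere_norm (n e : nat) (f : dhomog n R e) : R :=
  sup [set `|(f : {mpoly R[n]}).@[u 0]| | u in @unit_sphere n].

Definition represents (n d : nat) (L : {scalar dhomog n R (2 * d)})
    (A : tensmx R n d) : Prop :=
  forall a b, L (tens_monomial a b) = A a b.

(* The norm F1. It is meant for maximally symmetric A, where exactly one L
   represents A; sup is then a maximum, since dhomog n R (2 * d) is finite
   dimensional. *)
Definition normF1 (n d : nat) (A : tensmx R n d) : R :=
  sup [set y | exists (L : {scalar dhomog n R (2 * d)})
                      (f : dhomog n R (2 * d)),
         [/\ represents L A, sphere_norm f = 1 & y = L f]].

End Real.

Arguments Cd {R} n d.

(* Main.v *)
Require Import Defs.
From HB Require Import structures.
From mathcomp Require Import all_boot all_order all_fingroup all_algebra.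
From mathcomp Require Import polyrcf complex spectral sesquilinear.
From mathcomp.multinomials Require Import ssrcomplements mpoly.
From mathcomp Require Import boolp classical_sets reals.
From mathcomp Require Import zify ring lra.

Set Implicit Arguments.
Unset Strict Implicit.
Unset Printing Implicit Defensive.

Import Order.TTheory GRing.Theory Num.Theory.
Local Open Scope classical_set_scope.
Local Open Scope ring_scope.

(** A maximally symmetric positive semidefinite tensor M of trace one is the
    same thing as a linear functional ell on the forms of degree 2r with
    ell(g^2) >= 0 for every form g of degree r and ell(|x|^(2r)) = 1. Its partial
    trace represents the functional f |-> ell(|x|^(2(r-d)) f) on the forms of
    degree 2d, and a point tau of the convex hull represents integration
    against a probability measure on the unit sphere. So one has to find a
    measure mu whose integral of f differs from ell(|x|^(2(r-d)) f) by at most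
    C n^2/r^2 times the maximum of |f| on the sphere, with C depending on d only.

    Let K(x,y) be the square of a form of degree r in x and in y that depends
    only on |x|, |y| and <x,y>. For a Gaussian vector y, and f of degree 2d,
    E_y[K(x,y) f(y)] = |x|^(2(r-d)) (T f)(x) with T f again of degree 2d
    (lemma kernel_operator). Hence ell(|x|^(2(r-d)) T f) is the integral of f
    against the measure with density ell(K(.,y)), which is positive because
    K(.,y) is a square. If T, suitably normalised, is close to the identity,
    every f is T g with g close to f, and the error made on f is the integral of
    g - f (lemma kernel_measure).

    To compare T f with f at a unit vector x, the reflection in the axis of x is
    used: it preserves K and the Gaussian law, so f(y) may be replaced by the
    mean of f at y and at its mirror image, which differs from |y|^(2d) f(x)
    only to second order in the distance of y to the axis (lemma
    reflect_bound). This happens in a plane, whence a constant that does not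
    depend on n. So T is the identity up to a constant times the mean of
    s = 1 - <x,y>^2 on the sphere for the density K(x,y). On the sphere s
    follows a Beta law, and K is the square of a polynomial q in s, of degree
    about r/2, up to a factor <x,y>^2 when r is odd. The Jacobi polynomial q for
    the law multiplied by s^2 makes this mean at most a constant times n^2/r^2;
    the estimate comes from its differential equation (lemma
    jacobi_sq_moment_ratio).

    Gaussian expectation is treated as an algebraic functional on polynomials,
    defined by its moments and computed by Stein's identity. Its positivity, and
    the finitely many points of tau, come from Gaussian quadrature
    (lemma gauss_quadrature), itself a consequence of the spectral theorem.

    The inequality between the two norms is obtained by testing the functional
    represented by A on the form x |-> v^T S v, where v is the d-th tensor power
    of x and S is the matrix sign of A. *)

(** * Gaussian moments of polynomials *)

Section LinearExtension.
Variables (R : comNzRingType) (n : nat) (V : lmodType R).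
Variable E : 'X_{1..n} -> V.

Definition linext (p : {mpoly R[n]}) : V := \sum_(m <- msupp p) p@_m *: E m.

Lemma linextwE k p : (msize p <= k)%N ->
  linext p = \sum_(m : 'X_{1..n < k}) p@_m *: E m.
Proof.
move=> le_pk; rewrite /linext; set I : subFinType _ := 'X_{1..n < k}.
rewrite (big_mksub I) ?msupp_uniq //=; first last.
  by move=> x /msize_mdeg_lt /leq_trans; apply.
rewrite big_rmcond //= => j /memN_msupp_eq0 ->.
by rewrite scale0r.
Qed.

Lemma linext_is_linear : linear linext.
Proof.
move=> c p q; pose k := maxn (msize p) (msize q).
have hk : (msize (c *: p + q) <= k)%N.
  rewrite (leq_trans (msizeD_le _ _)) // geq_max /k leq_max leq_maxr andbT.
  by rewrite (leq_trans (msizeZ_le _ _)).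
rewrite !(@linextwE k) ?leq_maxl ?leq_maxr // scaler_sumr -big_split /=.
by apply: eq_bigr => m _; rewrite mcoeffD mcoeffZ scalerDl scalerA.
Qed.

HB.instance Definition _ :=
  GRing.isLinear.Build R {mpoly R[n]} V *:%R linext linext_is_linear.

Lemma linextX m : linext 'X_[m] = E m.
Proof. by rewrite /linext msuppX big_seq1 mcoeffX eqxx scale1r. Qed.

End LinearExtension.

Section Gauss.
Variable R : realType.

(** The moments of the standard normal law: (k-1)!! in even degree k, and 0 in odd
    degree. *)
Fixpoint gauss_moment (k : nat) : R :=
  match k with 0%N => 1 | 1%N => 0 | (j.+1 as k').+1 => k'%:R * gauss_moment j end.

Lemma gauss_momentS k : gauss_moment k.+1 = k%:R * gauss_moment k.-1.
Proof. by case: k => [|k] //=; rewrite mul0r. Qed.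

(** The expectation of p at a vector of n independent standard normal variables. *)
Definition gauss n : {mpoly R[n]} -> R^o :=
  linext (fun m : 'X_{1..n} => \prod_i gauss_moment (m i) : R^o).

HB.instance Definition _ n := GRing.Linear.copy (@gauss n)
  (linext (fun m : 'X_{1..n} => \prod_i gauss_moment (m i) : R^o)).

Lemma gaussX n (m : 'X_{1..n}) : gauss 'X_[m] = \prod_i gauss_moment (m i).
Proof. exact: linextX. Qed.

Lemma gauss1 n : gauss (1 : {mpoly R[n]}) = 1.
Proof. by rewrite -mpolyX0 gaussX big1 // => i _; rewrite mnm0E. Qed.

Lemma gaussD n (p q : {mpoly R[n]}) : gauss (p + q) = gauss p + gauss q.
Proof. exact: linearD. Qed.
Lemma gaussZ n c (p : {mpoly R[n]}) : gauss (c *: p) = c * gauss p.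
Proof. exact: linearZ. Qed.
Lemma gauss_sum n (I : Type) (r : seq I) P (F : I -> {mpoly R[n]}) :
  gauss (\sum_(i <- r | P i) F i) = \sum_(i <- r | P i) gauss (F i).
Proof. exact: linear_sum. Qed.

(** Integration by parts against the Gaussian density. On a monomial it is the
    recursion of the one-dimensional moments; all integrals below are computed
    from it. *)
Lemma gauss_stein n (i : 'I_n) (p : {mpoly R[n]}) :
  gauss ('X_i * p) = gauss p^`M(i).
Proof.
rewrite {1 2}(mpolyE p) mulr_sumr (linear_sum (mderiv i)) !gauss_sum.
apply: eq_bigr => m _ /=; rewrite mderivZ -scalerAr !gaussZ; congr (_ * _).
rewrite mderivX -mpolyXD gaussZ !gaussX.
rewrite (bigD1 i) // [in RHS](bigD1 i) //= mulrA.
congr (_ * _); last first.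
  by apply: eq_bigr => j ji; rewrite mnmBE mnmDE mnm1E eq_sym (negPf ji) subn0.
by rewrite mnmDE mnmBE mnm1E eqxx add1n subn1 gauss_momentS.
Qed.

End Gauss.

(** * Spectral resolution of real symmetric matrices *)

Section Spectral.
Variable R : realType.
Local Notation C := R[i].
Local Notation toC := (real_complex R).
Local Notation ReC := (@complex.Re R).
Local Open Scope sesquilinear_scope.

Lemma char_poly_conj (F : fieldType) m (P A B : 'M[F]_m) :
  P \in unitmx -> A = invmx P *m B *m P -> char_poly A = char_poly B.
Proof.
move=> Pu ->; rewrite /char_poly.
pose Q := map_mx polyC P; pose Q' := map_mx polyC (invmx P).
have QQ : Q' *m Q = 1%:M by rewrite -map_mxM mulVmx // map_mx1.
have -> : char_poly_mx (invmx P *m B *m P) = Q' *m char_poly_mx B *m Q.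
  rewrite /char_poly_mx !map_mxM mulmxBr mulmxBl; congr (_ - _).
  by rewrite -mulmxA -scalar_mxC mulmxA QQ mul1mx.
by rewrite !det_mulmx mulrAC -det_mulmx QQ det1 mul1r.
Qed.

Lemma Re_sum (I : Type) (r : seq I) P (F : I -> C) :
  ReC (\sum_(i <- r | P i) F i) = \sum_(i <- r | P i) ReC (F i).
Proof. by elim/big_rec2: _ => //= i x y _ <-; case: (F i) y => a b []. Qed.

Lemma Re_realM (a : R) (z : C) : ReC (toC a * z) = a * ReC z.
Proof. by case: z => x y /=; rewrite mul0r subr0. Qed.

(** E j is the real part of the orthogonal projection on the j-th vector of a
    unitary eigenbasis over the complex numbers. It need not be a projection,
    but it is positive semidefinite of trace one, so that functions of A become
    sums over the eigenvalues with nonnegative weights. *)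
Lemma spectral_resolution m (A : 'M[R]_m) : A^T = A ->
  exists (D : 'I_m -> R) (E : 'I_m -> 'M[R]_m),
    [/\ char_poly A = \prod_j ('X - (D j)%:P),
        forall j, A *m E j = D j *: E j,
        \sum_j E j = 1%:M,
        forall j (v : 'cV[R]_m), 0 <= (v^T *m E j *m v) 0 0 &
        forall j, \tr (E j) = 1].
Proof.
move=> Asym; pose Ac : 'M[C]_m := map_mx toC A.
have Aherm : Ac \is hermsymmx.
  apply: realsym_hermsym.
    apply/is_hermitianmxP; rewrite expr0 scale1r.
    by apply/matrixP => i j; rewrite !mxE -[in LHS]Asym mxE.
  by apply/mxOverP => i j; rewrite mxE; apply/complex_realP; exists (A i j).
have /orthomx_spectralP Aeq := hermitian_normalmx Aherm.
have /mxOverP Dreal := hermitian_spectral_diag_real Aherm.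
set P := spectralmx Ac in Aeq; set sp := spectral_diag Ac in Aeq Dreal.
have Pu : P \is unitarymx by exact: spectral_unitarymx.
have Pun := unitarymx_unit Pu.
have PP : P *m P^t* = 1%:M by apply/unitarymxP.
have PPV : P^t* *m P = 1%:M by rewrite -invmx_unitary // mulVmx.
rewrite invmx_unitary // in Aeq.
pose D j := ReC (sp 0 j).
have DE j : sp 0 j = toC (D j) by rewrite /D RRe_real.
pose F j := P^t* *m delta_mx j j *m P.
pose E j : 'M[R]_m := map_mx ReC (F j).
have AF j : Ac *m F j = toC (D j) *: F j.
  rewrite Aeq /F -!mulmxA; rewrite [P *m (_ *m _)]mulmxA PP mul1mx.
  rewrite [diag_mx _ *m _]mulmxA.
  have -> : diag_mx sp *m delta_mx j j = toC (D j) *: delta_mx j j :> 'M[C]_m.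
    apply/matrixP => a b; rewrite mul_diag_mx !mxE -DE.
    by case: (a =P j) => [->|_] //=; rewrite !mulr0.
  by rewrite -scalemxAl -scalemxAr.
exists D, E; split.
- apply: (map_poly_inj (real_complex R)).
  rewrite map_char_poly -/Ac (@char_poly_conj _ _ P Ac (diag_mx sp)) //; last first.
    by rewrite invmx_unitary.
  rewrite char_poly_trig ?diag_mx_is_trig // rmorph_prod.
  by apply: eq_bigr => j _; rewrite rmorphB /= map_polyX map_polyC /= mxE eqxx mulr1n DE.
- move=> j; apply/matrixP => a b; rewrite !mxE.
  have /matrixP/(_ a b) := AF j; rewrite !mxE => /(congr1 ReC).
  rewrite Re_realM Re_sum => <-; apply: eq_bigr => k _.
  by rewrite !mxE Re_realM.
- have <- : map_mx ReC (\sum_j F j) = 1%:M.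
    rewrite /F -mulmx_suml -mulmx_sumr.
    have -> : \sum_j delta_mx j j = 1%:M :> 'M[C]_m.
      apply/matrixP => a b; rewrite summxE mxE (bigD1 a) //= big1.
        by rewrite mxE eqxx addr0 eq_sym.
      by move=> k /negPf ka; rewrite mxE eq_sym ka.
    rewrite mulmx1 PPV; apply/matrixP => a b; rewrite !mxE.
    by case: eqP.
  apply/matrixP => a b; rewrite [in RHS]mxE !summxE Re_sum.
  by apply: eq_bigr => j _; rewrite mxE.
- move=> j v; pose vc : 'cV[C]_m := map_mx toC v.
  have -> : (v^T *m E j *m v) 0 0 = ReC ((vc^T *m F j *m vc) 0 0).
    rewrite !mxE Re_sum; apply: eq_bigr => k _.
    rewrite mxE (mxE _ _ k 0) mulrC [in RHS]mulrC Re_realM; congr (_ * _).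
    rewrite !mxE Re_sum; apply: eq_bigr => l _.
    by rewrite !mxE Re_realM.
  have vr : vc^T = vc^t*.
    by apply/matrixP => a b; rewrite !mxE; apply/esym/CrealP/complex_realP; exists (v b a).
  have -> : vc^T *m F j *m vc = (P *m vc)^t* *m delta_mx j j *m (P *m vc).
    by rewrite vr trmx_mul map_mxM /F !mulmxA.
  set u := P *m vc.
  have -> : (u^t* *m delta_mx j j *m u) 0 0 = (u j 0)^* * u j 0.
    rewrite mxE (bigD1 j) //= big1 ?addr0 => [|k /negPf kj].
      rewrite mxE (bigD1 j) //= big1 ?addr0 => [|k /negPf kj].
        by rewrite !mxE eqxx mulr1.
      by rewrite !mxE kj mulr0.
    rewrite mxE big1 ?mul0r // => l _.
    by rewrite !mxE kj andbF mulr0.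
  have := mul_conjC_ge0 (u j 0); rewrite mulrC.
  by case: (_ * _) => x y; rewrite lecE /= => /andP[].
- move=> j; rewrite /mxtrace.
  have <- : ReC (\tr (F j)) = 1.
    rewrite /F -mulmxA mxtrace_mulC -mulmxA PP mulmx1 /mxtrace.
    rewrite (bigD1 j) //= big1 ?addr0 ?mxE ?eqxx //.
    by move=> k /negPf kj; rewrite mxE kj.
  by rewrite /mxtrace Re_sum; apply: eq_bigr => k _; rewrite mxE.
Qed.

End Spectral.

(** * Gaussian quadrature *)

Section Quadrature.
Variable R : realType.

(** The k-th power of the operator x + d/dx applied to 1. *)
Fixpoint ladder_poly (k : nat) : {poly R} :=
  if k is j.+1 then 'X * ladder_poly j + (ladder_poly j)^`() else 1.

(** The commutator of d/dx and x + d/dx is 1. *)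
Lemma deriv_ladder_poly k : (ladder_poly k)^`() = k%:R *: ladder_poly k.-1.
Proof.
elim: k => [|k IHk]; first by rewrite /= derivC scale0r.
rewrite [ladder_poly k.+1]/= derivD derivM derivX mul1r IHk derivZ -scalerAr.
case: k IHk => [|k] IHk /=; first by rewrite !scale0r !addr0 scale1r.
by rewrite -addrA -scalerDr -[k.+2]addn1 natrD scalerDl scale1r addrC.
Qed.

Lemma size_ladder_poly k : (size (ladder_poly k) <= k.+1)%N.
Proof.
elim: k => [|k IHk]; first by rewrite /= size_poly1.
rewrite /= (leq_trans (size_polyD _ _)) // geq_max; apply/andP; split.
  by rewrite (leq_trans (size_polyMleq _ _)) // size_polyX.
rewrite /deriv (leq_trans (size_poly _ _)) // (leq_trans (leq_pred _)) //.
exact: leq_trans IHk _.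
Qed.

(** By the previous lemma the constant coefficients obey the recursion of the
    Gaussian moments. *)
Lemma ladder_poly_gauss_moment k : (ladder_poly k)`_0 = gauss_moment R k.
Proof.
elim/ltn_ind: k => -[|k] IHk; first by rewrite /= coef1.
rewrite gauss_momentS [ladder_poly _]/= coefD coefXM add0r.
rewrite deriv_ladder_poly coefZ; congr (_ * _).
by rewrite IHk // ltnS leq_pred.
Qed.

(** The operator x + d/dx on polynomials of degree at most N, in the basis
    x^i / sqrt(i!), where it is symmetric. *)
Definition ladder_mx N : 'M[R]_N.+1 :=
  \matrix_(i, j) ((j == i.+1 :> nat)%:R * Num.sqrt j%:R
                  + (i == j.+1 :> nat)%:R * Num.sqrt i%:R).

Lemma sum_ord_eq n a (F : nat -> R) :
  \sum_(j < n) (j == a :> nat)%:R * F j = (a < n)%:R * F a.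
Proof.
case: ltnP => [lt_an|le_na].
  rewrite (bigD1 (Ordinal lt_an)) //= eqxx big1 ?addr0 // => j /negPf ja.
  by rewrite -val_eqE /= in ja; rewrite ja mul0r.
rewrite mul0r big1 // => j _.
by rewrite (ltn_eqF (leq_trans (ltn_ord j) le_na)) mul0r.
Qed.

(** The truncation at degree N is not felt before the N-th power, as each
    application of x + d/dx raises the degree by one. *)
Lemma ladder_mx_iter N k i : (k <= N)%N ->
  (ladder_mx N ^+ k *m delta_mx 0 0 : 'cV_N.+1) i 0
     = Num.sqrt i`!%:R * (ladder_poly k)`_i.
Proof.
elim: k i => [|k IHk] i lek.
  rewrite expr0 mul1mx mxE /= coef1 andbT.
  by case: i => -[|i] ? /=; rewrite ?fact0 ?sqrtr1 ?mulr1 ?mulr0.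
rewrite exprS -mulmxA mxE.
under eq_bigr => j _ do rewrite IHk ?(ltnW lek) // mxE mulrDl -!mulrA.
rewrite big_split /= (@sum_ord_eq _ _
  (fun j => Num.sqrt j%:R * (Num.sqrt j`!%:R * (ladder_poly k)`_j))).
have -> : (i.+1 < N.+1)%:R
    * (Num.sqrt i.+1%:R * (Num.sqrt (i.+1)`!%:R * (ladder_poly k)`_i.+1))
     = Num.sqrt i`!%:R * (ladder_poly k)^`()`_i.
  rewrite coef_deriv factS natrM sqrtrM ?ler0n // !mulrA.
  case: ltnP => [_|lt]; last first.
    rewrite !mul0r nth_default ?mul0rn ?mulr0 //.
    exact: leq_trans (size_ladder_poly _) (leq_trans lek (ltnW lt)).
  by rewrite mul1r -expr2 sqr_sqrtr ?ler0n // mulrnAr -mulrA mulr_natl.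
rewrite /= coefD coefXM mulrDr addrC; congr (_ + _).
case: i => -[|a] lt_a /=.
  by rewrite mulr0 big1 // => j _; rewrite mul0r.
under eq_bigr => j _ do rewrite eqSS eq_sym.
rewrite (@sum_ord_eq _ _
  (fun j => Num.sqrt a.+1%:R * (Num.sqrt j`!%:R * (ladder_poly k)`_j))).
by rewrite (ltnW lt_a) mul1r mulrA factS natrM sqrtrM ?ler0n.
Qed.

(** The Gaussian moments are the (0,0) entries of the powers of ladder_mx N, which
    the spectral resolution writes as sums over the eigenvalues. *)
Lemma gauss_quadrature1 N : exists K (w D : 'I_K -> R),
  (forall j, 0 <= w j) /\
  forall k, (k <= N)%N -> \sum_j w j * D j ^+ k = gauss_moment R k.
Proof.
have Jsym : (ladder_mx N)^T = ladder_mx N.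
  by apply/matrixP => i j; rewrite !mxE addrC.
have [D [E [_ JE sumE E_ge0 _]]] := spectral_resolution Jsym.
exists N.+1, (fun j => E j 0 0), D; split => [j|k lek].
  have := E_ge0 j (delta_mx 0 0).
  by rewrite trmx_delta -rowE -colE !mxE.
have JkE j : ladder_mx N ^+ k *m E j = D j ^+ k *: E j.
  elim: k {lek} => [|k IHk]; first by rewrite !expr0 mul1mx scale1r.
  by rewrite exprSr -mulmxA JE -scalemxAr IHk scalerA -exprS.
have := @ladder_mx_iter N k 0 lek.
rewrite fact0 sqrtr1 mul1r ladder_poly_gauss_moment => <-.
rewrite -colE mxE -[ladder_mx N ^+ k]mulmx1 -sumE mulmx_sumr summxE.
by apply: eq_bigr => j _; rewrite JkE mxE mulrC.
Qed.

(** The product of one-dimensional rules. It makes the algebraic functional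
    positive, one degree at a time. *)
Lemma gauss_quadrature n D0 : exists (I : finType) (w : I -> R) (y : I -> 'I_n -> R),
  (forall j, 0 <= w j) /\
  forall p : {mpoly R[n]}, (msize p <= D0)%N ->
    gauss p = \sum_j w j * p.@[y j].
Proof.
have [K [w [D [w_ge0 wD]]]] := gauss_quadrature1 D0.
exists {ffun 'I_n -> 'I_K}, (fun g : {ffun 'I_n -> 'I_K} => \prod_i w (g i)),
  (fun (g : {ffun 'I_n -> 'I_K}) i => D (g i)); split.
  by move=> g; apply: prodr_ge0.
move=> p size_p; rewrite /gauss /linext; under [RHS]eq_bigr => g _ do rewrite mevalE mulr_sumr.
rewrite exchange_big /=; apply: eq_big_seq => m /msize_mdeg_lt lt_m.
under [RHS]eq_bigr => g _ do rewrite mulrCA -big_split /=.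
rewrite -mulr_sumr -(bigA_distr_bigA (fun i j => w j * D j ^+ m i)).
congr (_ * _); apply: eq_bigr => i _; rewrite wD //.
apply: leq_trans (leq_trans (ltnW lt_m) size_p).
by rewrite mdegE (bigD1 i) //= leq_addr.
Qed.

End Quadrature.

(** * Invariance of the Gaussian functional under rotations *)

Section Rotation.
Variable R : realType.

Lemma mnm_ind n (P : 'X_{1..n} -> Prop) :
  P 0%MM -> (forall i m, P m -> P (U_(i) + m)%MM) -> forall m, P m.
Proof.
move=> P0 PS m; move: {2}(mdeg m) (erefl (mdeg m)) => k; elim: k m => [|k IHk] m.
  by move/eqP; rewrite mdeg_eq0 => /eqP ->.
move=> dm; have [i mi] : exists i, m i != 0%N.
  apply/existsP; apply: contra_eqT dm => /existsPn m0.
  by rewrite mdegE big1 // => i _; apply/eqP; move: (m0 i); rewrite negbK.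
have Um : (U_(i) <= m)%MM by rewrite lep1mP.
rewrite -(submK Um) addmC; apply: PS; apply: IHk.
by move: (congr1 mdeg (submK Um)); rewrite mdegD mdeg1 addn1 dm => -[].
Qed.

Lemma mpoly_indX n (P : {mpoly R[n]} -> Prop) :
  (forall c, P c%:MP) -> (forall p q, P p -> P q -> P (p + q)) ->
  (forall i p, P p -> P ('X_i * p)) -> forall p, P p.
Proof.
move=> PC PD PX; suff Pm m c : P (c *: 'X_[m]).
  move=> p; rewrite (mpolyE p); apply: (big_ind P) => //.
  by rewrite -mpolyC0.
elim/mnm_ind: m => [|i m IHm]; first by rewrite mpolyX0 alg_mpolyC.
by rewrite mpolyXD scalerAr; apply: PX.
Qed.

Lemma mderivXU n (i j : 'I_n) : ('X_i : {mpoly R[n]})^`M(j) = (i == j)%:R.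
Proof.
rewrite mderivX mnm1E; case: eqP => [->|_]; last by rewrite scale0r.
by rewrite -[U_(j)%MM as X in (X - _)%MM]add0m addmK mpolyX0 scale1r.
Qed.

Lemma mderiv_comp n k (lq : n.-tuple {mpoly R[k]}) (p : {mpoly R[n]}) j :
  (p \mPo lq)^`M(j) = \sum_i (p^`M(i) \mPo lq) * (tnth lq i)^`M(j).
Proof.
elim/mpoly_indX: p => [c|p q IHp IHq|a p IHp].
- rewrite comp_mpolyC mderivC big1 // => i _.
  by rewrite mderivC comp_mpoly0 mul0r.
- rewrite comp_mpolyD mderivD IHp IHq -big_split /=.
  by apply: eq_bigr => i _; rewrite mderivD comp_mpolyD mulrDl.
- rewrite rmorphM /= mderivM IHp comp_mpolyXU -tnth_nth mulr_sumr.
  rewrite [in RHS](bigD1 a) // [in LHS](bigD1 a) //= mderivM !rmorphD !rmorphM /=.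
  rewrite comp_mpolyXU -tnth_nth mderivXU eqxx.
  rewrite rmorph1 mul1r mulrDl -addrA; congr (_ + (_ + _)); rewrite ?mulrA //.
    by rewrite mulrC.
  apply: eq_bigr => i /negPf ia; rewrite mderivM mderivXU eq_sym ia.
  by rewrite mul0r add0r rmorphM /= comp_mpolyXU -tnth_nth mulrA.
Qed.

Definition lin_sub n (O : 'M[R]_n) : n.-tuple {mpoly R[n]} :=
  [tuple \sum_j O i j *: 'X_j | i < n].

Lemma meval_lin_sub n (O : 'M[R]_n) p y :
  (p \mPo lin_sub O).@[y] = p.@[fun i => \sum_j O i j * y j].
Proof.
rewrite comp_mpoly_meval; apply: meval_eq => i.
rewrite tnth_mktuple raddf_sum /=; apply: eq_bigr => j _.
by rewrite mevalZ mevalXU.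
Qed.

(** Stein's identity and the value at 1 determine the functional, and composition
    with an orthogonal substitution preserves both. *)
Lemma gauss_rot n (O : 'M[R]_n) (p : {mpoly R[n]}) :
  O *m O^T = 1%:M -> gauss (p \mPo lin_sub O) = gauss p.
Proof.
move=> OO; rewrite (mpolyE p) (linear_sum (comp_mpoly (lin_sub O))) !gauss_sum.
apply: eq_bigr => m _ /=.
rewrite comp_mpolyZ !gaussZ; congr (_ * _).
move: {2}(mdeg m).+1 (ltnSn (mdeg m)) => k; elim: k m => // k IHk m.
elim/mnm_ind: m => [|i m _]; first by rewrite mpolyX0 rmorph1.
rewrite mdegD mdeg1 add1n ltnS => lt_mk.
rewrite mpolyXD rmorphM /= comp_mpolyXU -tnth_nth tnth_mktuple gauss_stein.
rewrite mulr_suml gauss_sum.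
have -> : gauss ('X_[m])^`M(i) = gauss (('X_[m])^`M(i) \mPo lin_sub O).
  rewrite mderivX comp_mpolyZ !gaussZ IHk //.
  by rewrite (leq_ltn_trans (mdegB _ _)).
transitivity (\sum_k0 (\sum_j O i j * O k0 j) * gauss (('X_[m])^`M(k0) \mPo lin_sub O)).
  under [RHS]eq_bigr => l _ do rewrite mulr_suml.
  rewrite exchange_big; apply: eq_bigr => j _ /=.
  rewrite -scalerAl gaussZ gauss_stein mderiv_comp gauss_sum mulr_sumr.
  apply: eq_bigr => l _; rewrite -mulrA; congr (_ * _).
  rewrite tnth_mktuple (linear_sum (mderiv j)) /= (bigD1 j) //= big1 => [|a /negPf aj].
    by rewrite addr0 linearZ /= mderivXU eqxx -scalerAr mulr1 gaussZ.
  by rewrite linearZ /= mderivXU aj scaler0.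
have OE k0 : \sum_j O i j * O k0 j = (i == k0)%:R.
  by move/matrixP: OO => /(_ i k0); rewrite !mxE => <-; apply: eq_bigr => j _; rewrite mxE.
rewrite (bigD1 i) //= OE eqxx mul1r big1 ?addr0 // => l /negPf li.
by rewrite OE eq_sym li mul0r.
Qed.

End Rotation.

(** * Gaussian integrals of radial and linear factors *)

Section Radial.
Variable R : realType.

Lemma mderiv_exp n (p : {mpoly R[n]}) i k :
  (p ^+ k)^`M(i) = k%:R *: (p ^+ k.-1 * p^`M(i)).
Proof.
elim: k => [|k IHk]; first by rewrite scale0r expr0 -mpolyC1 mderivC.
rewrite exprS mderivM IHk -scalerAr; case: k {IHk} => [|k] /=.
  by rewrite scale0r addr0 expr0 mul1r mulr1 scale1r.
by rewrite mulrA -exprS mulrC -[k.+2]addn1 natrD scalerDl scale1r addrC.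
Qed.

Lemma euler_homog n d (p : {mpoly R[n]}) : p \is d.-homog ->
  \sum_i 'X_i * p^`M(i) = d%:R *: p.
Proof.
move=> /dhomogP hp; rewrite {2}(mpolyE p) scaler_sumr.
under eq_bigr => i _ do rewrite {1}(mpolyE p) (linear_sum (mderiv i)) mulr_sumr /=.
rewrite exchange_big; apply: eq_big_seq => m /hp <- /=.
under eq_bigr => i _ do rewrite linearZ /= mderivX -!scalerAr -mpolyXD scalerA.
rewrite scalerA mdegE natr_sum mulr_suml scaler_suml.
apply: eq_bigr => i _; rewrite mulrC.
case: (m i =P 0%N) => [->|/eqP mi]; first by rewrite !mul0r !scale0r.
by rewrite addmC submK // lep1mP.
Qed.

Definition lform n (x : 'I_n -> R) : {mpoly R[n]} := \sum_i x i *: 'X_i.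
Definition sqnorm n : {mpoly R[n]} := \sum_i 'X_i ^+ 2.

Lemma meval_lform n (x y : 'I_n -> R) : (lform x).@[y] = \sum_i x i * y i.
Proof.
by rewrite /lform raddf_sum /=; apply: eq_bigr => i _; rewrite mevalZ mevalXU.
Qed.

Lemma meval_sqnorm n (y : 'I_n -> R) : (sqnorm n).@[y] = \sum_i y i ^+ 2.
Proof.
by rewrite /sqnorm raddf_sum /=; apply: eq_bigr => i _; rewrite rmorphXn /= mevalXU.
Qed.

Lemma mderiv_lform n (x : 'I_n -> R) i : (lform x)^`M(i) = (x i)%:MP.
Proof.
rewrite /lform (linear_sum (mderiv i)) (bigD1 i) //= big1 => [|j /negPf ji].
  by rewrite linearZ /= mderivXU eqxx addr0 alg_mpolyC.
by rewrite linearZ /= mderivXU ji scaler0.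
Qed.

Lemma mderiv_sqnorm n (i : 'I_n) : (sqnorm n)^`M(i) = 2 *: 'X_i.
Proof.
rewrite /sqnorm (linear_sum (mderiv i)) (bigD1 i) //= big1 => [|j /negPf ji].
  by rewrite mderiv_exp mderivXU eqxx addr0 mulr1 expr1.
by rewrite mderiv_exp mderivXU ji mulr0 scaler0.
Qed.

Lemma lform_homog n (x : 'I_n -> R) : lform x \is 1.-homog.
Proof. by apply: rpred_sum => i _; rewrite rpredZ // dhomogX /= mdeg1. Qed.

Lemma lform_exp_homog n (x : 'I_n -> R) k : lform x ^+ k \is k.-homog.
Proof. by rewrite -[X in X.-homog]mul1n dhomogMn ?lform_homog. Qed.

Lemma sqnorm_homog n : sqnorm n \is 2.-homog.
Proof.
apply: rpred_sum => i _; rewrite -[2%N]mul1n dhomogMn // dhomogX /=.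
by rewrite mdeg1.
Qed.

Lemma gauss_lform n (x : 'I_n -> R) p :
  gauss (lform x * p) = \sum_i x i * gauss p^`M(i).
Proof.
rewrite /lform mulr_suml gauss_sum; apply: eq_bigr => i _.
by rewrite -scalerAl gaussZ gauss_stein.
Qed.

Lemma gauss_lform_exp n (x : 'I_n -> R) a :
  gauss (lform x ^+ a.+2) = a.+1%:R * (sqnorm n).@[x] * gauss (lform x ^+ a).
Proof.
rewrite exprS gauss_lform meval_sqnorm -mulrA mulr_suml mulr_sumr; apply: eq_bigr => i _.
by rewrite mderiv_exp mderiv_lform gaussZ [_ * _%:MP]mulrC mul_mpolyC gaussZ /=; ring.
Qed.

Lemma gauss_lform_even n (x : 'I_n -> R) a :
  gauss (lform x ^+ (2 * a)) = (\prod_(l < a) (2 * l).+1%:R) * (sqnorm n).@[x] ^+ a.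
Proof.
elim: a => [|a IHa]; first by rewrite muln0 big_ord0 !expr0 gauss1 mulr1.
by rewrite mulnS [(2 + _)%N]/= gauss_lform_exp IHa big_ord_recr /= exprS; ring.
Qed.

(** Integrate X_i (X_i p) by parts and sum over i with Euler's identity. *)
Lemma gauss_sqnorm n d (p : {mpoly R[n]}) : p \is d.-homog ->
  gauss (sqnorm n * p) = (n + d)%:R * gauss p.
Proof.
move=> hp; rewrite /sqnorm mulr_suml gauss_sum.
under eq_bigr => i _ do rewrite expr2 -mulrA gauss_stein mderivM mderivXU eqxx mul1r gaussD.
rewrite big_split /= -(gauss_sum (index_enum _) xpredT (fun i => 'X_i * p^`M(i))).
rewrite (euler_homog hp) gaussZ.
by rewrite sumr_const card_ord -[X in X + _]mulr_natl natrD mulrDl.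
Qed.

Lemma gauss_sqnorm_exp n d (p : {mpoly R[n]}) j : p \is d.-homog ->
  gauss (sqnorm n ^+ j * p) = (\prod_(l < j) (n + d + 2 * l)%:R) * gauss p.
Proof.
move=> hp; elim: j => [|j IHj]; first by rewrite expr0 big_ord0 !mul1r.
rewrite exprS -mulrA (@gauss_sqnorm _ (2 * j + d)); last first.
  by apply: dhomogM => //; apply: dhomogMn; apply: sqnorm_homog.
by rewrite IHj big_ord_recr /= mulrA [_ * \prod_(_ < _) _]mulrC (addnC (2 * j)%N) addnA.
Qed.

(** When x is a unit vector: the squared distance to the line spanned by x. *)
Definition perp n (x : 'I_n -> R) : {mpoly R[n]} := sqnorm n - lform x ^+ 2.

Lemma perp_homog n (x : 'I_n -> R) : perp x \is 2.-homog.
Proof.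
by rewrite rpredB ?sqnorm_homog // -[2%N]mul1n dhomogMn // lform_homog.
Qed.

(** Put z = y - <x,y> x, so that perp x is the scalar product of y and z, and
    integrate y by parts: z has divergence n - 1, is orthogonal to x and is half
    the gradient of perp x. The outcome is the recursion for the moments of a
    chi-square law with n - 1 degrees of freedom. *)
Lemma gauss_perp n (x : 'I_n -> R) k a : (sqnorm n).@[x] = 1 ->
  gauss (perp x ^+ k.+1 * lform x ^+ a)
    = (n%:R - 1 + 2 * k%:R) * gauss (perp x ^+ k * lform x ^+ a).
Proof.
move=> x1; set t := lform x; set s := perp x.
pose z i := 'X_i - x i *: t.
have sE : s = \sum_i 'X_i * z i.
  rewrite /s /perp /sqnorm expr2 -/t {1}/t /lform mulr_suml -sumrB.
  by apply: eq_bigr => i _; rewrite mulrBr -scalerAr scalerAl expr2.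
have zx : \sum_i x i *: z i = 0.
  under eq_bigr => i _ do rewrite scalerBr scalerA -expr2.
  by rewrite sumrB -scaler_suml -meval_sqnorm x1 scale1r subrr.
have zz : \sum_i z i * z i = s.
  under eq_bigr => i _ do rewrite {1}/z mulrBl -scalerAl scalerAr.
  by rewrite sumrB -sE -mulr_sumr zx mulr0 subr0.
set g := perp x ^+ k * lform x ^+ a.
rewrite exprS -mulrA -/s -/g {1}sE mulr_suml gauss_sum.
under eq_bigr => i _ do rewrite -mulrA gauss_stein.
have dz i : (z i)^`M(i) = (1 - x i ^+ 2)%:MP.
  rewrite /z mderivB mderivXU eqxx mderivZ mderiv_lform.
  by rewrite -mul_mpolyC -mpolyCM -expr2 -mpolyC1 -mpolyCB.
have ds i : s^`M(i) = 2 *: z i.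
  rewrite /s /perp mderivB mderiv_sqnorm mderiv_exp mderiv_lform expr1 /z.
  by rewrite scalerBr [_ * _%:MP]mulrC mul_mpolyC.
have dg i : g^`M(i) = (2 * k%:R) *: (s ^+ k.-1 * t ^+ a * z i)
    + (a%:R) *: ((s ^+ k * t ^+ a.-1) * (x i)%:MP).
  rewrite /g mderivM !mderiv_exp mderiv_lform ds -/s -/t; congr (_ + _).
    by rewrite -scalerAl -scalerAr -scalerAl scalerA mulrAC [k%:R * _]mulrC.
  by rewrite -scalerAr mulrA.
under eq_bigr => i _ do rewrite mderivM dz dg gaussD mul_mpolyC gaussZ.
rewrite big_split /= -mulr_suml sumrB -meval_sqnorm x1 sumr_const card_ord.
rewrite -/t -/s -/g [in RHS]mulrDl; congr (_ + _).
rewrite -gauss_sum; under eq_bigr => i _ do rewrite mulrDr -!scalerAr.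
rewrite big_split /= -!scaler_sumr.
have -> : \sum_i z i * (s ^+ k * t ^+ a.-1 * (x i)%:MP) = 0.
  under eq_bigr => i _ do rewrite mulrCA [z i * _]mulrC mul_mpolyC.
  by rewrite -mulr_sumr zx mulr0.
have -> : \sum_i z i * (s ^+ k.-1 * t ^+ a * z i) = s * (s ^+ k.-1 * t ^+ a).
  under eq_bigr => i _ do rewrite mulrCA.
  by rewrite -mulr_sumr zz mulrC.
rewrite scaler0 addr0 gaussZ /g -/s -/t; case: (k) => [|k'] /=.
  by rewrite mulr0 !mul0r.
by rewrite mulrA -exprS.
Qed.

End Radial.

(** * Integrals entering the kernel *)

Section KernelIntegrals.
Variable R : realType.

(** The k-th moment of the Beta law with parameters A and b - A. *)
Definition beta (A b : R) k : R := \prod_(l < k) ((A + l%:R) / (b + l%:R)).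

(** The integral of |y|^(2D) <x,y>^(2e) for a unit vector x. *)
Definition radial_const n e D : R :=
  (\prod_(l < D) (n + 2 * e + 2 * l)%:R) * \prod_(l < e) (2 * l).+1%:R.

Lemma radial_const_gt0 n e D : (0 < n)%N -> 0 < radial_const n e D.
Proof.
move=> n0; rewrite mulr_gt0 // prodr_gt0 // => l _; rewrite ltr0n //.
by rewrite !addn_gt0 n0.
Qed.

(** On the sphere, 1 - <x,y>^2 follows the Beta law with parameters (n-1)/2 and
    1/2; the density <x,y>^(2e) turns the second parameter into 1/2 + e. *)
Lemma gauss_radial n (x : 'I_n -> R) e k D : (0 < n)%N ->
  (sqnorm R n).@[x] = 1 -> (k <= D)%N ->
  gauss (sqnorm R n ^+ (D - k) * (perp x ^+ k * lform x ^+ (2 * e)))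
    = radial_const n e D * beta ((n%:R - 1) / 2) (n%:R / 2 + e%:R) k.
Proof.
move=> n0 x1 lekD; have [j ->] : exists j, D = (k + j)%N.
  by exists (D - k)%N; rewrite subnKC.
rewrite addKn {D lekD}.
rewrite (@gauss_sqnorm_exp _ _ (2 * k + 2 * e)); last first.
  apply: dhomogM; first by apply: dhomogMn; apply: perp_homog.
  exact: lform_exp_homog.
have -> : gauss (perp x ^+ k * lform x ^+ (2 * e))
    = (\prod_(l < k) (n%:R - 1 + 2 * l%:R)) * \prod_(l < e) (2 * l).+1%:R.
  elim: k => [|k IHk].
    by rewrite expr0 big_ord0 !mul1r gauss_lform_even x1 expr1n mulr1.
  by rewrite gauss_perp // IHk big_ord_recr /=; ring.
rewrite /radial_const /beta big_split_ord /=.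
have -> : \prod_(i < j) (n + (2 * k + 2 * e) + 2 * i)%:R
    = \prod_(i < j) (n + 2 * e + 2 * (k + i))%:R :> R.
  by apply: eq_bigr => i _; congr _%:R; rewrite mulnDr; ring.
have -> : \prod_(l < k) (n%:R - 1 + 2 * l%:R)
   = (\prod_(l < k) (n + 2 * e + 2 * l)%:R) *
     \prod_(l < k) (((n%:R - 1) / 2 + l%:R) / (n%:R / 2 + e%:R + l%:R)) :> R.
  rewrite -big_split; apply: eq_bigr => l _ /=.
  have nR : 0 < n%:R :> R by rewrite ltr0n.
  have : n%:R / 2 + e%:R + l%:R != 0 :> R.
    by rewrite lt0r_neq0 // !ltr_pwDl ?ler0n // divr_gt0.
  move=> b0; apply: (mulIf b0); rewrite -[RHS]mulrA divfK //.
  by field.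
by ring.
Qed.

(** Integrate by parts the variables of the monomial one at a time. When the
    derivative falls on <x,y>^a a factor x_i comes out; when it falls on the
    rest of the monomial the degree drops by two, which is made up for by
    |x|^2. The two exponents A and B avoid negative powers of |x|. *)
Lemma gauss_lform_monomial n (m : 'X_{1..n}) a A B :
  (2 * A + a = 2 * B + mdeg m)%N ->
  exists2 g : {mpoly R[n]}, g \is (mdeg m).-homog &
    forall x, (sqnorm R n).@[x] ^+ A * gauss (lform x ^+ a * 'X_[m])
              = (sqnorm R n).@[x] ^+ B * g.@[x].
Proof.
move: {2}(mdeg m).+1 (ltnSn (mdeg m)) => k.
elim: k m a A B => // k IHk m.
elim/mnm_ind: m => [|i m _] a A B.
  rewrite mdeg0 addn0 mpolyX0 => _ aE.
  have [c ac] : exists c, a = (2 * c)%N.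
    by exists (B - A)%N; rewrite mulnBr -aE addKn.
  exists (\prod_(l < c) (2 * l).+1%:R)%:MP => [|x].
    by rewrite -alg_mpolyC rpredZ // dhomog1.
  rewrite mulr1 ac gauss_lform_even mevalC mulrCA -exprD [RHS]mulrC.
  congr (_ * _ ^+ _); move: aE; rewrite ac; lia.
rewrite mdegD mdeg1 add1n ltnS => lt_mk aE.
(* the derivative falls on the power of <x,y> *)
have [g1 g1h g1E] : exists2 g1 : {mpoly R[n]}, g1 \is (mdeg m).+1.-homog &
    forall x, (sqnorm R n).@[x] ^+ A * (a%:R * x i * gauss (lform x ^+ a.-1 * 'X_[m]))
              = (sqnorm R n).@[x] ^+ B * g1.@[x].
  case: a aE => [|a] aE.
    exists 0; first exact: dhomog0.
    by move=> x; rewrite !mul0r meval0 !mulr0.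
  have [||g gh gE] := IHk m a A B; [done | lia|].
  exists ((a.+1%:R *: 'X_i) * g).
    by apply: (@dhomogM _ _ _ 1) => //; rewrite rpredZ // dhomogX /= mdeg1.
  move=> x; rewrite mevalM mevalZ mevalXU mulrCA gE.
  by rewrite mulrCA.
(* the derivative falls on the rest of the monomial *)
have [g2 g2h g2E] : exists2 g2 : {mpoly R[n]}, g2 \is (mdeg m).+1.-homog &
    forall x, (sqnorm R n).@[x] ^+ A * gauss (lform x ^+ a * ('X_[m])^`M(i))
              = (sqnorm R n).@[x] ^+ B * g2.@[x].
  case: (posnP (m i)) => [m0|mi].
    exists 0; first exact: dhomog0.
    move=> x; rewrite mderivX m0 scale0r mulr0 meval0.
    by rewrite -[gauss 0]/(gauss (0 : {mpoly R[n]})) linear0 !mulr0.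
  have Um : (U_(i) <= m)%MM by rewrite lep1mP -lt0n.
  have dm : mdeg m = (mdeg (m - U_(i))%MM).+1.
    by rewrite -{1}(submK Um) mdegD mdeg1 addn1.
  have [||g gh gE] := IHk (m - U_(i))%MM a A B.+1; [lia|lia|].
  exists ((m i)%:R *: (sqnorm R n * g)).
    by rewrite rpredZ // dm; apply: (@dhomogM _ _ _ 2) => //; apply: sqnorm_homog.
  move=> x; rewrite mderivX -scalerAr gaussZ mulrCA gE mevalZ mevalM exprSr.
  by ring.
exists (g1 + g2); first by rewrite rpredD.
move=> x; rewrite mevalD mulrDr -g1E -g2E -mulrDr; congr (_ * _).
rewrite mpolyXD mulrCA gauss_stein mderivM gaussD; congr (_ + _).
rewrite mderiv_exp mderiv_lform -scalerAl gaussZ -mulrA [_ * _%:MP]mulrC.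
by rewrite -mulrA mul_mpolyC gaussZ [in RHS]mulrC; ring.
Qed.

End KernelIntegrals.

(** * A Jacobi polynomial concentrated at the origin *)

Section Jacobi.
Variable R : realType.
Variables (A b : R) (N : nat).
Hypotheses (A_ge0 : 0 <= A) (b_gt0 : 0 < b).

Let c : R := N%:R * (N%:R + b + 1).

(** Coefficients of the polynomial solution q, with q(0) = 1, of the equation
    s(1-s)q'' + (A + 2 - (b + 2)s)q' + N(N + b + 1)q = 0, that is, of the Jacobi
    polynomial of degree N for the measure s^2 dB, where dB has the moments
    beta A b. Thanks to the two extra powers of s, the density q^2 concentrates
    dB at distance of order 1/N^2 from the origin. *)
Fixpoint jacobi_coef k : R :=
  if k is j.+1 then
    jacobi_coef j * (j%:R * (j%:R + b + 1) - N%:R * (N%:R + b + 1)) / (k%:R * (j%:R + A + 2))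
  else 1.

Lemma jacobi_coefS k : (k.+1%:R * (k%:R + A + 2)) * jacobi_coef k.+1
   = jacobi_coef k * (k%:R * (k%:R + b + 1) - c).
Proof.
rewrite /= mulrCA mulfV ?mulr1 //.
by rewrite mulf_neq0 ?pnatr_eq0 // lt0r_neq0 // ltr_wpDl // addr_ge0 ?ler0n.
Qed.

Lemma jacobi_coef_last : jacobi_coef N.+1 = 0.
Proof. by rewrite /= subrr mulr0 mul0r. Qed.

Lemma betaS k : (b + k%:R) * beta A b k.+1 = (A + k%:R) * beta A b k.
Proof.
rewrite /beta big_ord_recr /= mulrCA mulrA -mulrA [RHS]mulrC; congr (_ * _).
by rewrite mulrC divfK // lt0r_neq0 // ltr_wpDr ?ler0n.
Qed.

(** The integral of s^i q. *)
Definition jacobi_moment i := \sum_(k < N.+1) jacobi_coef k * beta A b (k + i).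

(** The differential equation integrated against powers of s. In terms of
    coefficients, the difference of the two sides is the sum of U k.+1 - U k,
    which telescopes to zero since q has degree N. *)
Lemma jacobi_moment_rec i : jacobi_moment i.+1 * ((i%:R - 1) * (i%:R + b) - c)
  = (i%:R - 1) * (i%:R + A) * jacobi_moment i.
Proof.
pose U k : R := k%:R * (k%:R + A + 1) * jacobi_coef k * beta A b (k + i).
have : \sum_(0 <= k < N.+1) (U k.+1 - U k) = 0.
  by rewrite telescope_sumr // /U jacobi_coef_last !(mul0r, mulr0) subr0.
rewrite big_mkord => sumU; apply/eqP; rewrite -subr_eq0 -[X in _ == X]sumU; apply/eqP.
rewrite /jacobi_moment mulr_suml mulr_sumr -sumrB; apply: eq_bigr => k _.
have q1 := jacobi_coefS k; have b1 := betaS (k + i); rewrite natrD in b1.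
have -> : U k.+1 = jacobi_coef k * (k%:R * (k%:R + b + 1) - c) * beta A b (k + i).+1.
  rewrite -q1 /U -[in RHS]natr1 addSn; ring.
rewrite /U addnS.
apply/eqP; rewrite -subr_eq0; apply/eqP.
transitivity (jacobi_coef k * (i%:R - 1 - k%:R) *
  ((b + (k%:R + i%:R)) * beta A b (k + i).+1 - (A + (k%:R + i%:R)) * beta A b (k + i))).
  by ring.
by rewrite b1 subrr mulr0.
Qed.

Lemma jacobi_moment0 : A * jacobi_moment 0 = (N%:R + 1) * (N%:R + b) * jacobi_moment 1.
Proof. by move: (jacobi_moment_rec 0); rewrite /c => E; nra. Qed.

(** Orthogonality of q to low degrees for s^2 dB: the recursion starts at i = 1
    with a zero right hand side, and the coefficient on its left does not vanish
    for i <= N. *)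
Lemma jacobi_moment_eq0 i : (1 < i <= N.+1)%N -> jacobi_moment i = 0.
Proof.
elim: i => // i IHi /andP[lt0 ltN].
have nz : (i%:R - 1) * (i%:R + b) - c != 0.
  rewrite lt_eqF // subr_lt0 /c.
  have i1 : 0 <= i%:R - 1 :> R by rewrite subr_ge0 ler1n.
  have iN : 0 <= N%:R - i%:R :> R by rewrite subr_ge0 ler_nat.
  have := mulr_ge0 i1 iN; have := mulr_ge0 (ltW b_gt0) iN.
  have := mulr_ge0 iN iN; move: b_gt0; nra.
apply: (mulIf nz); rewrite mul0r jacobi_moment_rec.
case: i IHi lt0 ltN {nz} => [|[|i]] IHi // _ ltN; first by rewrite subrr !mul0r.
by rewrite IHi ?mulr0 // (leq_trans _ ltN).
Qed.

(** The integral of s^i q^2. *)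
Definition jacobi_sq_moment i :=
  \sum_(k < N.+1) \sum_(l < N.+1) jacobi_coef k * jacobi_coef l * beta A b (k + l + i).

Lemma jacobi_sq_momentE i :
  jacobi_sq_moment i = \sum_(k < N.+1) jacobi_coef k * jacobi_moment (k + i).
Proof.
apply: eq_bigr => k _; rewrite /jacobi_moment mulr_sumr; apply: eq_bigr => l _.
by rewrite mulrA; congr (_ * beta _ _ _); lia.
Qed.

Lemma jacobi_sq_moment1E : jacobi_sq_moment 1 = jacobi_moment 1.
Proof.
rewrite jacobi_sq_momentE big_ord_recl /= mul1r big1 ?addr0 // => k _.
by rewrite jacobi_moment_eq0 ?mulr0 // addn1 /= !ltnS.
Qed.

(** By orthogonality only the first two coefficients of q contribute to the
    integral of q * q, and only the first one to that of s q * q; this leaves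
    moments 0 and 1 of q, whose ratio is known. *)
Lemma jacobi_sq_moment_ratio : (0 < N)%N -> 0 <= jacobi_sq_moment 1 ->
  2 * N%:R ^+ 2 * jacobi_sq_moment 1 <= A * (A + 2) * jacobi_sq_moment 0.
Proof.
move=> N0; rewrite jacobi_sq_moment1E => I1.
have -> : jacobi_sq_moment 0 = jacobi_moment 0 + jacobi_coef 1 * jacobi_moment 1.
  rewrite jacobi_sq_momentE big_ord_recl /= mul1r; case: N N0 jacobi_moment_eq0 => // N' _ H.
  rewrite big_ord_recl big1 => [|k _]; first by rewrite addr0.
  by rewrite H ?mulr0 //; case: k => k lt_k; rewrite /= /bump; lia.
have q0 := jacobi_moment0.
have A2 : 0 < A + 2 by rewrite ltr_wpDl.
have -> : A * (A + 2) * (jacobi_moment 0 + jacobi_coef 1 * jacobi_moment 1)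
   = (A + 2) * (A * jacobi_moment 0) + A * ((A + 2) * jacobi_coef 1) * jacobi_moment 1 by ring.
have -> : (A + 2) * jacobi_coef 1 = - c.
  by move: (jacobi_coefS 0); rewrite [jacobi_coef 0]/=; set x := jacobi_coef 1; lra.
rewrite q0 /c -subr_ge0.
have -> : (A + 2) * ((N%:R + 1) * (N%:R + b) * jacobi_moment 1)
     + A * - (N%:R * (N%:R + b + 1)) * jacobi_moment 1 - 2 * N%:R ^+ 2 * jacobi_moment 1
  = (2 * (N%:R * b + N%:R + b) + A * b) * jacobi_moment 1 by ring.
by rewrite mulr_ge0 // addr_ge0 ?mulr_ge0 ?addr_ge0 ?mulr_ge0 ?ler0n // ltW.
Qed.

Lemma beta_small k : A <= b -> 0 <= beta A b k.+1 <= A / b.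
Proof.
move=> le_Ab.
have pos l : 0 < b + l%:R by rewrite ltr_wpDr ?ler0n.
have fpos l : 0 <= (A + l%:R) / (b + l%:R) <= 1.
  rewrite divr_ge0 ?(ltW (pos l)) ?addr_ge0 ?ler0n //=.
  by rewrite ler_pdivrMr // mul1r lerD2r.
rewrite /beta big_ord_recl /= !addr0.
have A0 : 0 <= A / b by rewrite divr_ge0 // ltW.
have /andP[h0 h1] : 0 <= \prod_(i < k) ((A + (lift ord0 i)%:R) / (b + (lift ord0 i)%:R)) <= 1.
  elim/big_rec: _ => [|i x _ /andP[x0 x1]]; first by rewrite ler01 lexx.
  have /andP[f0 f1] := fpos (lift ord0 i).
  by rewrite mulr_ge0 //= mulr_ile1.
by rewrite mulr_ge0 //= ler_piMr.
Qed.

End Jacobi.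

(** When j grows, the Beta law concentrates at 0, where the polynomial with
    coefficients q takes the value 1. *)
Lemma sum_beta_pos (R : realType) (A b : R) (q : nat -> R) N :
  0 <= A -> 0 < b -> A <= b -> q 0%N = 1 ->
  exists j, 0 < \sum_(k < N.+1) q k * beta A (b + j%:R) k.
Proof.
move=> A0 b0 Ab q0; pose s := \sum_(k < N) `|q k.+1|.
have s0 : 0 <= s by apply: sumr_ge0.
exists (Num.bound (A * s)); set j := Num.bound _.
have js : A * s < j%:R by apply: archi_boundP; rewrite mulr_ge0.
have bj : 0 < b + j%:R by rewrite ltr_wpDr ?ler0n.
rewrite big_ord_recl /= q0 mul1r {1}/beta big_ord0.
set t := \sum_(_ < _) _.
suff : `|t| < 1 by rewrite ltr_norml => /andP[]; lra.
apply: le_lt_trans (_ : A / (b + j%:R) * s < 1); last first.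
  by rewrite mulrAC ltr_pdivrMr // mul1r (lt_trans js) // ltrDr.
rewrite /t (le_trans (ler_norm_sum _ _ _)) // /s mulr_sumr.
apply: ler_sum => k _; rewrite normrM mulrC ler_wpM2r //.
have Abj : A <= b + j%:R by rewrite (le_trans Ab) // lerDl.
have /andP[h0 h1] := beta_small A0 bj k Abj.
by rewrite ger0_norm.
Qed.

(** * Even parts of univariate polynomials *)

Section Univariate.
Variable R : realType.

(** Interpolation at the nodes 0, ..., e. *)
Lemma coef_bound e : exists2 K : R, 0 <= K &
  forall (p : {poly R}) (B : R), (size p <= e.+1)%N ->
    (forall k : 'I_e.+1, `|p.[k%:R]| <= B) -> forall j, `|p`_j| <= K * B.
Proof.
pose a : 'rV[R]_e.+1 := \row_j j%:R.
pose V := Vandermonde e.+1 a.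
have Vu : V \in unitmx.
  rewrite unitmxE det_Vandermonde unitfE; apply/prodf_neq0 => i _.
  apply/prodf_neq0 => j lt_ij; rewrite !mxE subr_eq0 eqr_nat.
  by rewrite neq_ltn lt_ij orbT.
exists (\sum_j \sum_k `|invmx V k j|).
  by apply: sumr_ge0 => j _; apply: sumr_ge0.
move=> p B size_p pB j.
have B0 : 0 <= B := le_trans (normr_ge0 _) (pB ord0).
case: (ltnP j e.+1) => [lt_j|le_j]; last first.
  rewrite nth_default ?(leq_trans size_p) // normr0 mulr_ge0 //.
  by apply: sumr_ge0 => i _; apply: sumr_ge0.
pose c : 'rV[R]_e.+1 := \row_i p`_i.
have cV : c *m V = \row_k p.[k%:R].
  apply/rowP => k; rewrite !mxE (horner_coef_wide _ size_p).
  by apply: eq_bigr => i _; rewrite !mxE.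
have -> : p`_j = (\row_k p.[k%:R] *m invmx V) 0 (Ordinal lt_j).
  by rewrite -cV mulmxK // mxE.
set S := \sum_j _.
have leS : \sum_k `|invmx V k (Ordinal lt_j)| <= S.
  rewrite /S [leRHS](bigD1 (Ordinal lt_j)) //= lerDl.
  by apply: sumr_ge0 => i _; apply: sumr_ge0.
rewrite mxE (le_trans (ler_norm_sum _ _ _)) //.
apply: le_trans (ler_wpM2r B0 leS); rewrite mulr_suml.
by apply: ler_sum => k _; rewrite normrM mulrC mxE ler_wpM2l.
Qed.

(** Taking the even part removes the linear term; the remaining terms of positive
    degree carry a factor u^2, and all coefficients are controlled by the values
    at finitely many points. *)
Lemma even_part_bound d : (0 < d)%N -> exists2 K : R, 2 <= K &
  forall (p : {poly R}) B, (size p <= (2 * d).+1)%N ->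
    (forall u, `|p.[u]| <= B * (1 + u ^+ 2) ^+ d) ->
    forall u, `|(p.[u] + p.[- u]) / 2 - (1 + u ^+ 2) ^+ d * p.[0]|
       <= K * B * (u ^+ 2 * (1 + u ^+ 2) ^+ d.-1).
Proof.
move=> d0; have [K0 K00 K0P] := coef_bound (2 * d).
(* a bound for (1 + u^2)^d at the nodes u = 0, ..., 2d *)
pose M : R := (1 + (2 * d)%:R ^+ 2) ^+ d.
have M0 : 0 <= M by rewrite exprn_ge0 // addr_ge0 // sqr_ge0.
exists ((2 * d)%:R * (K0 * M) + d%:R + 2).
  by rewrite lerDr addr_ge0 ?mulr_ge0.
move=> p B size_p pB u.
have B0 : 0 <= B.
  by have := pB 0; rewrite expr0n addr0 expr1n mulr1; apply: le_trans.
have cB j : `|p`_j| <= K0 * (B * M).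
  apply: K0P => // k; apply: le_trans (pB _) _; rewrite ler_wpM2l //.
  rewrite lerXn2r ?nnegrE ?addr_ge0 ?sqr_ge0 // lerD2l.
  by rewrite lerXn2r ?nnegrE // ler_nat -ltnS.
set W := u ^+ 2; set T := W * _.
have W0 : 0 <= W by rewrite sqr_ge0.
have T0 : 0 <= T by rewrite mulr_ge0 // exprn_ge0 // addr_ge0.
have evenT j : (0 < j <= 2 * d)%N -> `|(u ^+ j + (- u) ^+ j) / 2| <= T.
  case/andP=> j0 jd; rewrite exprNn; have jE := odd_double_half j.
  rewrite -signr_odd; case: (odd j) jE => [_|].
    by rewrite expr1 mulN1r subrr mul0r normr0.
  rewrite add0n => jE; rewrite mul1r -mulr2n -[X in X / 2]mulr_natr mulfK ?pnatr_eq0 //.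
  have [i ji] : exists i, j = (2 * i.+1)%N.
    by exists (j./2).-1; rewrite prednK -?mul2n ?half_gt0; lia.
  rewrite ji exprM -/W ger0_norm ?(exprn_ge0 _ W0) // exprS /T ler_wpM2l //.
  have leid : (i <= d.-1)%N by lia.
  rewrite -(subnKC leid) exprD -[X in X <= _]mulr1 ler_pM ?(exprn_ge0 _ W0) //.
    by rewrite lerXn2r ?nnegrE ?addr_ge0 // lerDr.
  by rewrite exprn_ege1 // lerDl.
have p0 : p.[0] = p`_0 by rewrite horner_coef0.
have -> : (p.[u] + p.[- u]) / 2 - (1 + W) ^+ d * p.[0]
  = \sum_(j < 2 * d) p`_j.+1 * ((u ^+ j.+1 + (- u) ^+ j.+1) / 2)
    - ((1 + W) ^+ d - 1) * p`_0.
  rewrite p0 !(horner_coef_wide _ size_p) -big_split /= mulr_suml.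
  rewrite big_ord_recl !expr0 mulr1.
  have -> : \sum_(i < 2 * d)
       (p`_(lift ord0 i) * u ^+ lift ord0 i + p`_(lift ord0 i) * (- u) ^+ lift ord0 i) / 2
     = \sum_(j < 2 * d) p`_j.+1 * ((u ^+ j.+1 + (- u) ^+ j.+1) / 2).
    by apply: eq_bigr => i _; rewrite -mulrDr mulrA.
  by field.
have h1 : `|\sum_(j < 2 * d) p`_j.+1 * ((u ^+ j.+1 + (- u) ^+ j.+1) / 2)|
    <= (2 * d)%:R * (K0 * M) * B * T.
  rewrite (le_trans (ler_norm_sum _ _ _)) //.
  have -> : (2 * d)%:R * (K0 * M) * B * T = \sum_(j < 2 * d) (K0 * (B * M)) * T.
    by rewrite sumr_const card_ord -[RHS]mulr_natl; ring.
  by apply: ler_sum => j _; rewrite normrM; apply: ler_pM => //; apply: evenT; apply: ltn_ord.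
have h2 : `|((1 + W) ^+ d - 1) * p`_0| <= d%:R * B * T.
  rewrite normrM subrX1 addrC addKr.
  have pB0 : `|p`_0| <= B.
    by have := pB 0; rewrite p0 expr0n addr0 expr1n mulr1.
  have -> : d%:R * B * T = (d%:R * T) * B by ring.
  rewrite ler_pM // normrM ger0_norm // /T mulrCA ler_wpM2l //.
  rewrite (le_trans (ler_norm_sum _ _ _)) //.
  have -> : d%:R * (1 + W) ^+ d.-1 = \sum_(i < d) (1 + W) ^+ d.-1.
    by rewrite sumr_const card_ord mulr_natl.
  apply: ler_sum => i _; rewrite ger0_norm ?exprn_ge0 ?addr_ge0 //.
  by rewrite ler_weXn2l ?lerDl // -ltnS prednK.
rewrite (le_trans (ler_normB _ _)) // (le_trans (lerD h1 h2)) //.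
have -> : ((2 * d)%:R * (K0 * M) + d%:R + 2) * B * T
  = (2 * d)%:R * (K0 * M) * B * T + d%:R * B * T + 2 * (B * T) by ring.
by rewrite lerDl mulr_ge0 // mulr_ge0.
Qed.

End Univariate.

(** * Forms on the unit sphere *)

Section Sphere.
Variable R : realType.

Lemma meval_homog n d (p : {mpoly R[n]}) c v : p \is d.-homog ->
  p.@[fun i => c * v i] = c ^+ d * p.@[v].
Proof.
move=> /dhomogP hp; rewrite !mevalE mulr_sumr; apply: eq_big_seq => m /hp dm.
rewrite mulrCA; congr (_ * _); rewrite -dm /= mdegE expr_sum -big_split /=.
by apply: eq_bigr => i _; rewrite exprMn.
Qed.

(** By Stein's identity the annihilated polynomials are stable under
    differentiation, and no nonzero constant is annihilated. *)
Lemma gauss_null n (p : {mpoly R[n]}) :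
  (forall q, gauss (p * q) = 0) -> p = 0.
Proof.
move: {2}(msize p) (leqnn (msize p)) => k; elim: k p => [|k IHk] p le_pk Pp.
  by apply/eqP; rewrite -msize_poly_eq0 -leqn0.
have dp i : p^`M(i) = 0.
  apply: IHk => [|q].
    apply/bigmax_leqP_seq => m; rewrite mcoeff_msupp mcoeff_deriv => dm _.
    have : (m + U_(i))%MM \in msupp p.
      by rewrite mcoeff_msupp; apply: contraNneq dm => ->; rewrite mul0rn.
    by move/msize_mdeg_lt; rewrite mdegD mdeg1 addn1 => /leq_trans/(_ le_pk).
  have := Pp ('X_i * q); rewrite mulrCA gauss_stein mderivM gaussD => E.
  by rewrite -[RHS]E Pp addr0.
(* all partial derivatives vanish, so p is constant *)
have pE : p = (p@_0%MM)%:MP.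
  apply/mpolyP => m; rewrite mcoeffC; case: eqP => [->|/eqP m0]; first by rewrite mulr1.
  have [i mi] : exists i, m i != 0%N.
    apply/existsP; apply: contraNT m0 => /existsPn m0.
    by apply/eqP/mnmP => i; rewrite mnm0E; apply/eqP; move: (m0 i); rewrite negbK.
  have Um : (U_(i) <= m)%MM by rewrite lep1mP.
  have := congr1 (mcoeff (m - U_(i))%MM) (dp i).
  rewrite mcoeff_deriv submK // mcoeff0 mulr0 => /eqP.
  by rewrite mulrn_eq0 /= => /eqP.
have := Pp 1; rewrite mulr1 pE -alg_mpolyC gaussZ gauss1 mulr1 => ->.
by rewrite scale0r.
Qed.

(** Quadrature sees only values, so all integrals against p vanish. *)
Lemma mpoly_eval0 n (p : {mpoly R[n]}) : (forall v, p.@[v] = 0) -> p = 0.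
Proof.
move=> p0; apply: gauss_null => q.
have [I [w [y [_ ->]]]] := gauss_quadrature R n (msize (p * q)); last exact: leqnn.
by rewrite big1 // => j _; rewrite mevalM p0 mul0r mulr0.
Qed.

Lemma sqnorm_ge0 n (v : 'I_n -> R) : 0 <= (sqnorm R n).@[v].
Proof. by rewrite meval_sqnorm sumr_ge0 // => i _; apply: sqr_ge0. Qed.

Lemma sqnorm_eq0 n (v : 'I_n -> R) : (sqnorm R n).@[v] = 0 -> forall i, v i = 0.
Proof.
move=> /eqP; rewrite meval_sqnorm psumr_eq0 => [/allP v0 i|i _]; last exact: sqr_ge0.
by have := v0 i (mem_index_enum i); rewrite sqrf_eq0 => /eqP.
Qed.

Lemma sqnorm_scale n c (v : 'I_n -> R) :
  (sqnorm R n).@[fun i => c * v i] = c ^+ 2 * (sqnorm R n).@[v].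
Proof. exact/meval_homog/sqnorm_homog. Qed.

Lemma sphere_scale n (v : 'I_n -> R) : (sqnorm R n).@[v] != 0 ->
  exists2 u : 'I_n -> R, (sqnorm R n).@[u] = 1 &
    v =1 (fun i => Num.sqrt (sqnorm R n).@[v] * u i).
Proof.
move=> v0; set s := Num.sqrt _.
have s0 : s != 0 by rewrite sqrtr_eq0 -ltNge lt_neqAle eq_sym v0 sqnorm_ge0.
exists (fun i => s^-1 * v i); last by move=> i; rewrite mulVKf.
by rewrite sqnorm_scale exprVn sqr_sqrtr ?sqnorm_ge0 // mulVf.
Qed.

Lemma meval_homog0 n d (p : {mpoly R[n]}) v : (0 < d)%N -> p \is d.-homog ->
  (sqnorm R n).@[v] = 0 -> p.@[v] = 0.
Proof.
move=> d0 hp v0; rewrite (@meval_eq _ _ v (fun i => 0 * v i)).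
  by rewrite (meval_homog _ _ hp) expr0n -[d]prednK // mul0r.
by move=> i; rewrite mul0r (sqnorm_eq0 v0).
Qed.

Lemma homog_sphere0 n d (p : {mpoly R[n]}) : (0 < d)%N -> p \is d.-homog ->
  (forall u, (sqnorm R n).@[u] = 1 -> p.@[u] = 0) -> p = 0.
Proof.
move=> d0 hp p0; apply: mpoly_eval0 => v.
case: (eqVneq (sqnorm R n).@[v] 0) => [v0|v0]; first exact: meval_homog0 hp v0.
have [u u1 vE] := sphere_scale v0.
by rewrite (meval_eq _ vE) (meval_homog _ _ hp) p0 // mulr0.
Qed.

Lemma homog_bound n d (p : {mpoly R[n]}) B v : (0 < d)%N ->
  p \is (2 * d).-homog ->
  (forall u, (sqnorm R n).@[u] = 1 -> `|p.@[u]| <= B) ->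
  `|p.@[v]| <= B * (sqnorm R n).@[v] ^+ d.
Proof.
move=> d0 hp pB; case: (eqVneq (sqnorm R n).@[v] 0) => [v0|v0].
  rewrite (meval_homog0 _ hp v0) ?muln_gt0 // v0 expr0n -[d]prednK //=.
  by rewrite mulr0 normr0.
have [u u1 vE] := sphere_scale v0.
rewrite (meval_eq _ vE) (meval_homog _ _ hp) exprM sqr_sqrtr ?sqnorm_ge0 //.
rewrite normrM ger0_norm ?exprn_ge0 ?sqnorm_ge0 // mulrC.
by rewrite ler_wpM2r ?exprn_ge0 ?sqnorm_ge0 ?pB.
Qed.

(** The restriction of a polynomial to the line u |-> x + u w. *)
Definition pline n (x w : 'I_n -> R) : {mpoly R[n]} -> {poly R} :=
  mmap (@polyC R) (fun i => (x i)%:P + w i *: 'X).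

Lemma horner_pline n (x w : 'I_n -> R) p u :
  (pline x w p).[u] = p.@[fun i => x i + u * w i].
Proof.
rewrite /pline /mmap mevalE horner_sum; apply: eq_bigr => m _.
rewrite hornerM hornerC; congr (_ * _); rewrite /mmap1 horner_prod.
by apply: eq_bigr => i _; rewrite horner_exp !hornerE mulrC.
Qed.

Lemma size_pline n (x w : 'I_n -> R) d p : p \is d.-homog ->
  (size (pline x w p) <= d.+1)%N.
Proof.
move=> /dhomogP hp; rewrite /pline /mmap.
apply: (leq_trans (size_sum _ _ _)); apply/bigmax_leqP_seq => m /hp <- _ /=.
rewrite mul_polyC (leq_trans (size_scale_leq _ _)) // mdegE /mmap1.
elim/big_rec2: _ => [|i k q _ le_qk]; first by rewrite size_poly1.
rewrite (leq_trans (size_polyMleq _ _)) //.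
have : (size (((x i)%:P + w i *: 'X) ^+ m i)%R <= (m i).+1)%N.
  have s2 : (size ((x i)%:P + w i *: 'X)%R <= 2)%N.
    rewrite (leq_trans (size_polyD _ _)) // geq_max size_polyC.
    by rewrite (leq_trans (size_scale_leq _ _)) ?size_polyX // andbT; case: eqP.
  rewrite (leq_trans (size_poly_exp_leq _ _)) // ltnS -[leqRHS]mul1n leq_mul2r.
  by move: s2; case: (size _) => [|s] s2; rewrite ?orbT // [X in _ || X]s2 orbT.
by move=> s1; rewrite -subn1 leq_subLR (leq_trans (leq_add s1 le_qk)) // addSn addnS.
Qed.

End Sphere.

(** * Averaging over a reflection *)

Section Reflection.
Variable R : realType.

Lemma meval_perp n (x y : 'I_n -> R) :
  (perp x).@[y] = (sqnorm R n).@[y] - (lform x).@[y] ^+ 2.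
Proof. by rewrite /perp mevalB rmorphXn. Qed.

Lemma sqnorm_perp n (x y : 'I_n -> R) : (sqnorm R n).@[x] = 1 ->
  (sqnorm R n).@[fun i => y i - (lform x).@[y] * x i] = (perp x).@[y].
Proof.
move=> x1; rewrite meval_perp; set t := (lform x).@[y]; rewrite meval_sqnorm.
transitivity (\sum_i (y i ^+ 2 + t ^+ 2 * x i ^+ 2 - (2 * t) * (x i * y i))).
  by apply: eq_bigr => i _; ring.
rewrite sumrB big_split /= -!mulr_sumr -!meval_sqnorm -meval_lform x1 -/t.
by ring.
Qed.

Lemma perp_ge0 n (x y : 'I_n -> R) : (sqnorm R n).@[x] = 1 -> 0 <= (perp x).@[y].
Proof. by move=> x1; rewrite -sqnorm_perp // sqnorm_ge0. Qed.

(** Let w be the unit vector orthogonal to x in the plane of x and y. On the line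
    x + u w the form f is a univariate polynomial, and the reflection in the axis
    of x changes u into -u, so the term of first order disappears from the mean.
    The constant depends on the degree only, because n has no bearing on what
    happens in a plane. *)
Lemma reflect_bound d : (0 < d)%N -> exists2 K : R, 0 <= K &
  forall n (f : {mpoly R[n]}) (B : R) (x y : 'I_n -> R),
    f \is (2 * d).-homog -> (sqnorm R n).@[x] = 1 ->
    (forall u, (sqnorm R n).@[u] = 1 -> `|f.@[u]| <= B) ->
    `|(f.@[y] + f.@[fun i => 2 * (lform x).@[y] * x i - y i]) / 2
        - (sqnorm R n).@[y] ^+ d * f.@[x]|
      <= K * B * ((perp x).@[y] * (sqnorm R n).@[y] ^+ d.-1).
Proof.
move=> d0; have [K K2 KP] := even_part_bound R d0.
have K0 : 0 <= K by apply: le_trans K2.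
exists K => // n f B x y hf x1 fB.
have B0 : 0 <= B by apply: le_trans (fB _ x1).
set t := (lform x).@[y]; set s := (perp x).@[y].
have sE : (sqnorm R n).@[y] = t ^+ 2 + s by rewrite /s meval_perp -/t addrC subrK.
have s0 : 0 <= s by apply: perp_ge0.
have rhs0 : 0 <= K * B * (s * (sqnorm R n).@[y] ^+ d.-1).
  by rewrite !mulr_ge0 // exprn_ge0 // sqnorm_ge0.
pose z i := y i - t * x i.
have zs : (sqnorm R n).@[z] = s by rewrite /z sqnorm_perp.
have xz : \sum_i x i * z i = 0.
  rewrite /z; under eq_bigr => i _ do rewrite mulrBr mulrCA -expr2.
  by rewrite sumrB -mulr_sumr -meval_sqnorm x1 -meval_lform mulr1 subrr.
case: (eqVneq s 0) => [s_eq0|s_neq0].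
  have z0 i : y i = t * x i.
    by apply/eqP; rewrite -subr_eq0; apply/eqP; apply: (sqnorm_eq0 (v := z)); rewrite zs.
  rewrite [X in (X + _) / 2](_ : _ = t ^+ (2 * d) * f.@[x]); last first.
    by rewrite -(meval_homog _ _ hf); apply: meval_eq.
  rewrite [X in (_ + X) / 2](_ : _ = t ^+ (2 * d) * f.@[x]); last first.
    by rewrite -(meval_homog _ _ hf); apply: meval_eq => i; rewrite z0; ring.
  rewrite sE s_eq0 addr0 -exprM -mulr2n -[X in X / 2]mulr_natr mulfK ?pnatr_eq0 //.
  by rewrite subrr normr0 mul0r mulr0.
case: (eqVneq t 0) => [t0|t0].
  have -> : f.@[fun i => 2 * t * x i - y i] = f.@[y].
    rewrite (@meval_eq _ _ _ (fun i => (-1) * y i)) => [|i].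
      by rewrite (meval_homog _ _ hf) exprM sqrrN expr1n expr1n mul1r.
    by rewrite t0; ring.
  rewrite -mulr2n -[X in X / 2]mulr_natr mulfK ?pnatr_eq0 //.
  rewrite (le_trans (ler_normB _ _)) //.
  have yE : (sqnorm R n).@[y] = s by rewrite sE t0 expr0n add0r.
  have h1 := homog_bound y d0 hf fB.
  have h2 : `|(sqnorm R n).@[y] ^+ d * f.@[x]| <= B * (sqnorm R n).@[y] ^+ d.
    rewrite normrM mulrC [`|_ ^+ d|]ger0_norm ?exprn_ge0 ?sqnorm_ge0 //.
    by rewrite ler_wpM2r ?exprn_ge0 ?sqnorm_ge0 ?fB.
  apply: (le_trans (lerD h1 h2)); rewrite -yE -exprS prednK //.
  rewrite -mulrA -mulr2n -[X in X <= _]mulr_natl ler_wpM2r //.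
  by rewrite mulr_ge0 // exprn_ge0 ?sqnorm_ge0.
have sgt0 : 0 < s by rewrite lt_neqAle eq_sym s_neq0.
pose v := Num.sqrt s.
have v2 : v ^+ 2 = s by rewrite sqr_sqrtr.
have v0 : v != 0 by rewrite sqrtr_eq0 -ltNge.
pose w i := v^-1 * z i.
have w1 : (sqnorm R n).@[w] = 1 by rewrite sqnorm_scale zs exprVn v2 mulVf.
have zE i : z i = v * w i by rewrite /w mulVKf.
have xw : \sum_i x i * w i = 0.
  by rewrite /w; under eq_bigr => i _ do rewrite mulrCA; rewrite -mulr_sumr xz mulr0.
(* y = t x + v w, so y / t lies on the line x + u w at u = v / t *)
pose p := pline x w f.
have pE u : p.[u] = f.@[fun i => x i + u * w i] by rewrite horner_pline.
have pB u : `|p.[u]| <= B * (1 + u ^+ 2) ^+ d.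
  rewrite pE (le_trans (homog_bound _ d0 hf fB)) //.
  suff -> : (sqnorm R n).@[fun i => x i + u * w i] = 1 + u ^+ 2 by [].
  rewrite meval_sqnorm.
  transitivity (\sum_i (x i ^+ 2 + u ^+ 2 * w i ^+ 2 + (2 * u) * (x i * w i))).
    by apply: eq_bigr => i _; ring.
  by rewrite !big_split /= -!mulr_sumr -!meval_sqnorm x1 w1 xw mulr1 mulr0 addr0.
have size_p : (size p <= (2 * d).+1)%N by apply: size_pline.
have {KP} := KP p B size_p pB (v / t).
have fy : f.@[y] = t ^+ (2 * d) * p.[v / t].
  rewrite pE -(meval_homog _ _ hf); apply: meval_eq => i.
  by rewrite mulrDr mulrA [t * (v / t)]mulrC divfK // -zE /z addrC subrK.
have fy' : f.@[fun i => 2 * t * x i - y i] = t ^+ (2 * d) * p.[- (v / t)].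
  rewrite pE -(meval_homog _ _ hf); apply: meval_eq => i.
  by rewrite mulrDr mulNr mulrN mulrA [t * (v / t)]mulrC divfK // -zE /z; ring.
have fx : f.@[x] = p.[0].
  by rewrite pE; apply: meval_eq => i; rewrite mul0r addr0.
have t2 : t ^+ 2 != 0 by rewrite expf_neq0.
have yE : (sqnorm R n).@[y] = t ^+ 2 * (1 + (v / t) ^+ 2).
  by rewrite expr_div_n v2 sE mulrDr mulr1 mulrCA divff // mulr1.
have sE2 : s = t ^+ 2 * (v / t) ^+ 2 by rewrite expr_div_n v2 mulrCA divff // mulr1.
rewrite fy fy' fx yE sE2 => KP.
set u := v / t in KP *.
have -> : (t ^+ (2 * d) * p.[u] + t ^+ (2 * d) * p.[- u]) / 2
    - (t ^+ 2 * (1 + u ^+ 2)) ^+ d * p.[0]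
  = t ^+ (2 * d) * ((p.[u] + p.[- u]) / 2 - (1 + u ^+ 2) ^+ d * p.[0]).
  by rewrite exprMn -exprM; field.
rewrite normrM.
have tt : t ^+ (2 * d) = t ^+ 2 * (t ^+ 2) ^+ d.-1 by rewrite exprM -exprS prednK.
have tge0 : 0 <= t ^+ (2 * d) by rewrite exprM exprn_ge0 // sqr_ge0.
rewrite ger0_norm // (le_trans (ler_wpM2l tge0 KP)) // tt.
by rewrite le_eqVlt; apply/orP; left; apply/eqP; rewrite !exprMn; ring.
Qed.

(** The reflection in the line spanned by a unit vector x. *)
Definition reflmx n (x : 'I_n -> R) : 'M[R]_n :=
  \matrix_(i, j) (2 * x i * x j - (i == j)%:R).

Lemma reflmx_apply n (x y : 'I_n -> R) i :
  \sum_j reflmx x i j * y j = 2 * (lform x).@[y] * x i - y i.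
Proof.
under eq_bigr => j _ do rewrite mxE mulrBl.
rewrite sumrB; congr (_ - _).
  rewrite meval_lform mulr_sumr mulr_suml; apply: eq_bigr => j _; ring.
rewrite (bigD1 i) //= eqxx mul1r big1 ?addr0 // => j /negPf ji.
by rewrite eq_sym ji mul0r.
Qed.

Lemma reflmx_orthogonal n (x : 'I_n -> R) : (sqnorm R n).@[x] = 1 ->
  reflmx x *m (reflmx x)^T = 1%:M.
Proof.
move=> x1; apply/matrixP => i k; rewrite mxE.
under eq_bigr => j _ do rewrite [(_^T) _ _]mxE.
rewrite (reflmx_apply x (fun j => reflmx x k j)) !mxE meval_lform.
have -> : \sum_j x j * reflmx x k j = x k.
  under eq_bigr => j _ do rewrite mulrC.
  by rewrite reflmx_apply meval_lform; under eq_bigr => j _ do rewrite -expr2;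
     rewrite -meval_sqnorm x1; ring.
by rewrite eq_sym; ring.
Qed.

Lemma lform_refl n (x : 'I_n -> R) : (sqnorm R n).@[x] = 1 ->
  lform x \mPo lin_sub (reflmx x) = lform x.
Proof.
move=> x1; apply/eqP; rewrite -subr_eq0; apply/eqP/mpoly_eval0 => y.
rewrite mevalB meval_lin_sub (meval_eq _ (reflmx_apply x y)).
rewrite (meval_lform x (fun i => _)).
under eq_bigr => i _ do rewrite mulrBr mulrCA -expr2.
by rewrite sumrB -mulr_sumr -meval_sqnorm x1 -meval_lform; ring.
Qed.

Lemma sqnorm_refl n (x : 'I_n -> R) : (sqnorm R n).@[x] = 1 ->
  sqnorm R n \mPo lin_sub (reflmx x) = sqnorm R n.
Proof.
move=> x1; apply/eqP; rewrite -subr_eq0; apply/eqP/mpoly_eval0 => y.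
rewrite mevalB meval_lin_sub (meval_eq _ (reflmx_apply x y)).
set t := (lform x).@[y]; rewrite !meval_sqnorm.
rewrite -sumrB.
transitivity (\sum_i ((4 * t ^+ 2) * x i ^+ 2 - (4 * t) * (x i * y i))).
  by apply: eq_bigr => i _; ring.
by rewrite sumrB -!mulr_sumr -meval_sqnorm x1 -meval_lform -/t; ring.
Qed.

End Reflection.

(** * The kernel *)

Section Kernel.
Variable R : realType.

Lemma gaussB n (p r : {mpoly R[n]}) : gauss (p - r) = gauss p - gauss r.
Proof. exact: linearB. Qed.

Lemma gauss_ge0 n (p : {mpoly R[n]}) : (forall y, 0 <= p.@[y]) -> 0 <= gauss p.
Proof.
move=> p0; have [I [w [y [w0 ->]]]] := gauss_quadrature R n (msize p); last exact: leqnn.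
by apply: sumr_ge0 => j _; rewrite mulr_ge0.
Qed.

Lemma gauss_le_norm n (p q : {mpoly R[n]}) :
  (forall y, `|p.@[y]| <= q.@[y]) -> `|gauss p| <= gauss q.
Proof.
move=> pq; have [I [w [y [w0 E]]]] := gauss_quadrature R n (maxn (msize p) (msize q)).
rewrite !E ?leq_maxl ?leq_maxr // (le_trans (ler_norm_sum _ _ _)) //.
by apply: ler_sum => j _; rewrite normrM ger0_norm // ler_wpM2l.
Qed.

(** If the integral of p^2 s vanished, so would each term of a quadrature rule for
    it, and with them the integral of p h s. *)
Lemma gauss_sq_gt0 n (p h s : {mpoly R[n]}) : (forall y, 0 <= s.@[y]) ->
  gauss (p * h * s) != 0 -> 0 < gauss (p ^+ 2 * s).
Proof.
move=> s0; apply: contraNT; rewrite -leNgt => le0.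
have [I [w [y [w0 E]]]] :=
  gauss_quadrature R n (maxn (msize (p * h * s)) (msize (p ^+ 2 * s))).
rewrite E ?leq_maxl // big1 // => j _; move: le0; rewrite E ?leq_maxr // => le0.
have t0 i : 0 <= w i * (p ^+ 2 * s).@[y i].
  by rewrite mulr_ge0 // mevalM rmorphXn /= mulr_ge0 // sqr_ge0.
have /eqP : \sum_i w i * (p ^+ 2 * s).@[y i] = 0.
  by apply/eqP; rewrite eq_le le0 sumr_ge0.
rewrite psumr_eq0 // => /allP /(_ j (mem_index_enum j)).
rewrite !mevalM !mulf_eq0 orbb.
by case/or3P=> /eqP ->; rewrite ?(mul0r, mulr0).
Qed.

Variables (N e : nat) (q : nat -> R).

(** As a function of the point y, this is the homogenisation in |x|^2 |y|^2 of the
    polynomial sum_k q_k s^k, where s = |x|^2 |y|^2 - <x,y>^2. *)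
Definition kernel_radial n (x : 'I_n -> R) : {mpoly R[n]} :=
  \sum_(k < N.+1) q k *:
     (((sqnorm R n).@[x] *: sqnorm R n - lform x ^+ 2) ^+ k
      * ((sqnorm R n).@[x] *: sqnorm R n) ^+ (N - k)).

(** The kernel is the square of this form; the factor <x,y>^e takes care of the
    parity of the degree. *)
Definition kernel_root n (x : 'I_n -> R) : {mpoly R[n]} := lform x ^+ e * kernel_radial x.

Lemma kernel_radial_unit n (x : 'I_n -> R) : (sqnorm R n).@[x] = 1 ->
  kernel_radial x = \sum_(k < N.+1) q k *: (perp x ^+ k * sqnorm R n ^+ (N - k)).
Proof. by move=> x1; rewrite /kernel_radial x1 scale1r. Qed.

Lemma lform_sym n (x y : 'I_n -> R) : (lform x).@[y] = (lform y).@[x].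
Proof. by rewrite !meval_lform; apply: eq_bigr => i _; rewrite mulrC. Qed.

Lemma meval_kernel_radial n (x y : 'I_n -> R) :
  (kernel_radial x).@[y] = \sum_(k < N.+1) q k *
    (((sqnorm R n).@[x] * (sqnorm R n).@[y] - (lform x).@[y] ^+ 2) ^+ k
     * ((sqnorm R n).@[x] * (sqnorm R n).@[y]) ^+ (N - k)).
Proof.
rewrite /kernel_radial (raddf_sum (meval y)); apply: eq_bigr => k _ /=.
by rewrite !mevalZ !mevalM !rmorphXn /= !mevalB !mevalZ !rmorphXn.
Qed.

Lemma kernel_root_sym n (x y : 'I_n -> R) : (kernel_root x).@[y] = (kernel_root y).@[x].
Proof.
rewrite !mevalM !rmorphXn /= lform_sym !meval_kernel_radial lform_sym.
by under eq_bigr => k _ do rewrite [(sqnorm R n).@[x] * _]mulrC.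
Qed.

Lemma kernel_root_homog n (x : 'I_n -> R) : kernel_root x \is (2 * N + e).-homog.
Proof.
rewrite addnC; apply: dhomogM.
  by rewrite -[e in e.-homog]mul1n dhomogMn ?lform_homog.
apply: rpred_sum => k _; rewrite rpredZ //.
have kN : (k <= N)%N by rewrite -ltnS.
have -> : (2 * N = 2 * k + 2 * (N - k))%N by rewrite -mulnDr subnKC.
apply: dhomogM; apply: dhomogMn; last by rewrite rpredZ // sqnorm_homog.
by rewrite rpredB ?rpredZ ?sqnorm_homog // -[2%N]mul1n dhomogMn // lform_homog.
Qed.

Lemma perp_refl n (x : 'I_n -> R) : (sqnorm R n).@[x] = 1 ->
  perp x \mPo lin_sub (reflmx x) = perp x.
Proof. by move=> x1; rewrite /perp comp_mpolyB rmorphXn /= lform_refl // sqnorm_refl. Qed.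

Lemma kernel_root_refl n (x : 'I_n -> R) : (sqnorm R n).@[x] = 1 ->
  kernel_root x \mPo lin_sub (reflmx x) = kernel_root x.
Proof.
move=> x1; rewrite /kernel_root kernel_radial_unit // rmorphM rmorphXn /= lform_refl //.
congr (_ * _); move: (perp_refl x1) (sqnorm_refl x1) => sE rE.
rewrite (raddf_sum (comp_mpoly _)); apply: eq_bigr => k _ /=.
by rewrite comp_mpolyZ rmorphM (rmorphXn (comp_mpoly _)) (rmorphXn (comp_mpoly _)) /= sE rE.
Qed.

Local Notation A n := ((n%:R - 1) / 2 : R).
Local Notation b n := (n%:R / 2 + e%:R : R).
Local Notation kernel_sq_moment n i :=
  (\sum_(k < N.+1) \sum_(l < N.+1) q k * q l * beta (A n) (b n) (k + l + i)).

Lemma kernel_root_sq_expand n (s r t : {mpoly R[n]}) d i : (i <= d)%N ->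
  (t ^+ e * \sum_(k < N.+1) q k *: (s ^+ k * r ^+ (N - k))) ^+ 2 * (s ^+ i * r ^+ (d - i))
   = \sum_(k < N.+1) \sum_(l < N.+1) (q k * q l) *:
       (r ^+ (2 * N + d - (k + l + i)) * (s ^+ (k + l + i) * t ^+ (2 * e))).
Proof.
move=> le_id; pose a (k : 'I_N.+1) := q k *: (s ^+ k * r ^+ (N - k)).
have -> : (t ^+ e * \sum_(k < N.+1) q k *: (s ^+ k * r ^+ (N - k))) ^+ 2
    = t ^+ (2 * e) * \sum_k \sum_l a k * a l.
  rewrite exprMn -exprM mulnC expr2 big_distrl; congr (_ * _).
  by apply: eq_bigr => k _; rewrite big_distrr.
rewrite mulrAC mulr_sumr; apply: eq_bigr => k _.
rewrite mulr_sumr; apply: eq_bigr => l _; rewrite /a.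
rewrite -scalerAl -!scalerAr scalerA; congr (_ *: _).
have kN : (k <= N)%N by rewrite -ltnS.
have lN : (l <= N)%N by rewrite -ltnS.
have -> : (2 * N + d - (k + l + i) = (N - k) + (N - l) + (d - i))%N by lia.
by rewrite !exprD; ring.
Qed.

Lemma gauss_kernel_root_moment n d i (x : 'I_n -> R) : (0 < n)%N ->
  (i <= d)%N -> (sqnorm R n).@[x] = 1 ->
  gauss (kernel_root x ^+ 2 * (perp x ^+ i * sqnorm R n ^+ (d - i)))
    = radial_const R n e (2 * N + d) * kernel_sq_moment n i.
Proof.
move=> n0 le_id x1; rewrite /kernel_root kernel_radial_unit // kernel_root_sq_expand //.
rewrite gauss_sum mulr_sumr; apply: eq_bigr => k _.
rewrite gauss_sum mulr_sumr; apply: eq_bigr => l _.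
rewrite gaussZ gauss_radial //; first by rewrite mulrCA.
have := ltn_ord k; have := ltn_ord l; lia.
Qed.

(** The kernel and the Gaussian functional are invariant under the reflection, so
    f may be replaced by its mean over the reflection. *)
Lemma kernel_estimate n d (f : {mpoly R[n]}) (K B : R) (x : 'I_n -> R) :
  (0 < n)%N -> (0 < d)%N -> f \is (2 * d).-homog -> (sqnorm R n).@[x] = 1 ->
  (forall y, `|(f.@[y] + f.@[fun i => 2 * (lform x).@[y] * x i - y i]) / 2
        - (sqnorm R n).@[y] ^+ d * f.@[x]|
      <= K * B * ((perp x).@[y] * (sqnorm R n).@[y] ^+ d.-1)) ->
  `|gauss (kernel_root x ^+ 2 * f)
      - radial_const R n e (2 * N + d) * kernel_sq_moment n 0 * f.@[x]|
    <= K * B * (radial_const R n e (2 * N + d) * kernel_sq_moment n 1).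
Proof.
move=> n0 d0 hf x1 est.
rewrite -(gauss_kernel_root_moment n0 (leq0n d) x1) -(gauss_kernel_root_moment n0 d0 x1).
rewrite !expr0 !expr1 mul1r subn0 subn1.
have gf : gauss (kernel_root x ^+ 2 * f)
    = gauss (kernel_root x ^+ 2 * (2^-1 *: (f + (f \mPo lin_sub (reflmx x))))).
  rewrite -scalerAr gaussZ mulrDr gaussD.
  rewrite -[in X in _ + X](kernel_root_refl x1) -rmorphXn -rmorphM /=.
  by rewrite gauss_rot ?reflmx_orthogonal //; field.
rewrite gf [_ * f.@[x]]mulrC -!gaussZ -gaussB.
move: (kernel_root x) (perp x) est => P s est {gf}.
apply: gauss_le_norm => y.
rewrite mevalB !mevalZ !mevalM mevalZ mevalD !rmorphXn /= meval_lin_sub.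
rewrite (meval_eq _ (reflmx_apply x y)).
have := est y; set E1 := (_ / 2 - _); set E2 := _ * _ ^+ d.-1 => h.
set g := P.@[y].
have -> : g ^+ 2 * (2^-1 * (f.@[y] + f.@[fun i => 2 * (lform x).@[y] * x i - y i]))
   - f.@[x] * (g ^+ 2 * (sqnorm R n).@[y] ^+ d) = g ^+ 2 * E1.
  by rewrite /E1; field.
rewrite normrM ger0_norm ?sqr_ge0 // mulrCA.
by rewrite ler_wpM2l // sqr_ge0.
Qed.

Lemma kernel_sq_moment1_ge0 n (x : 'I_n -> R) : (0 < n)%N -> (sqnorm R n).@[x] = 1 ->
  0 <= kernel_sq_moment n 1.
Proof.
move=> n0 x1; have := gauss_kernel_root_moment n0 (leqnn 1) x1 => E.
rewrite -(pmulr_rge0 _ (radial_const_gt0 R e (2 * N + 1) n0)) -E.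
apply: gauss_ge0 => y; rewrite subnn expr0 expr1 mulr1 mevalM rmorphXn /=.
by rewrite mulr_ge0 ?sqr_ge0 // perp_ge0.
Qed.

(** Test kernel_root against <x,y>^(e + 2j) for a large j. *)
Lemma kernel_sq_moment0_gt0 n (x : 'I_n -> R) : (0 < n)%N -> (sqnorm R n).@[x] = 1 ->
  q 0%N = 1 -> 0 < kernel_sq_moment n 0.
Proof.
move=> n0 x1 q0.
have := gauss_kernel_root_moment n0 (leqnn 0) x1; rewrite !expr0 !mulr1 => E.
rewrite -(pmulr_rgt0 _ (radial_const_gt0 R e (2 * N + 0) n0)) -E.
have A0 : 0 <= A n by rewrite divr_ge0 // subr_ge0 ler1n.
have b0 : 0 < b n by rewrite ltr_pwDl // divr_gt0 // ltr0n.
have Ab : A n <= b n.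
  have e0 : 0 <= e%:R :> R by [].
  by lra.
have [j jP] := sum_beta_pos N A0 b0 Ab q0.
rewrite -[_ ^+ 2]mulr1; apply: (@gauss_sq_gt0 _ _ (lform x ^+ (e + 2 * j))).
  by move=> y; rewrite meval1.
rewrite mulr1 /kernel_root kernel_radial_unit // mulrAC -exprD.
have -> : (e + (e + 2 * j) = 2 * (e + j))%N by lia.
rewrite mulr_sumr gauss_sum.
have -> : \sum_(k < N.+1) gauss (lform x ^+ (2 * (e + j))
                 * (q k *: (perp x ^+ k * sqnorm R n ^+ (N - k))))
  = radial_const R n (e + j) N * \sum_(k < N.+1) q k * beta (A n) (b n + j%:R) k.
  rewrite mulr_sumr; apply: eq_bigr => k _.
  rewrite -scalerAr gaussZ [RHS]mulrCA; congr (_ * _).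
  have kN : (k <= N)%N by rewrite -ltnS.
  by rewrite -addrA -natrD -(gauss_radial (e + j) n0 x1) //; congr gauss; ring.
by rewrite mulf_neq0 // lt0r_neq0 // radial_const_gt0.
Qed.

End Kernel.

(** * The kernel operator *)

Section Divisibility.
Variables (R : realType) (n d : nat).
Implicit Type F : ('I_n -> R) -> {mpoly R[n]}.

Lemma gauss_mulE (p f : {mpoly R[n]}) :
  gauss (p * f) = \sum_(m <- msupp f) f@_m * gauss (p * 'X_[m]).
Proof.
rewrite {1}(mpolyE f) mulr_sumr gauss_sum; apply: eq_bigr => m _.
by rewrite -scalerAr gaussZ.
Qed.

Definition scaled_sqnorm (x : 'I_n -> R) : {mpoly R[n]} := (sqnorm R n).@[x] *: sqnorm R n.

(** Here d is fixed, and s counts half of the degree of F in y. The exponents i and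
    j make the property stable when F is multiplied by <x,y>^2 or |x|^2 |y|^2. *)
Definition divides_degree (s : nat) F : Prop :=
  forall i j (m : 'X_{1..n}), mdeg m = (2 * d)%N -> (d <= s + i + j)%N ->
  exists2 g : {mpoly R[n]}, g \is (2 * d).-homog &
    forall x, gauss (F x * (lform x ^+ (2 * i) * scaled_sqnorm x ^+ j) * 'X_[m])
              = (sqnorm R n).@[x] ^+ (s + i + j - d) * g.@[x].

Lemma divides_degree1 : divides_degree 0 (fun _ => 1).
Proof.
move=> i j m dm; rewrite add0n => le_d.
have [|g hg gE] := @gauss_lform_monomial R n m (2 * i) j (i + j - d).
  by rewrite dm; lia.
rewrite dm in hg.
exists ((\prod_(l < j) (n + (2 * i + 2 * d) + 2 * l)%:R : R) *: g); first by rewrite rpredZ.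
move=> x.
have -> : 1 * (lform x ^+ (2 * i) * scaled_sqnorm x ^+ j) * 'X_[m]
   = (sqnorm R n).@[x] ^+ j *: (sqnorm R n ^+ j * (lform x ^+ (2 * i) * 'X_[m])).
  by rewrite mul1r /scaled_sqnorm exprZn -scalerAr -scalerAl; congr (_ *: _); ring.
rewrite gaussZ (@gauss_sqnorm_exp _ _ (2 * i + 2 * d)); last first.
  apply: dhomogM; last by rewrite dhomogX /= dm.
  exact: lform_exp_homog.
by rewrite mevalZ [RHS]mulrCA -gE; ring.
Qed.

Lemma divides_degree_lform s F : divides_degree s F ->
  divides_degree s.+1 (fun x => F x * lform x ^+ 2).
Proof.
move=> HF i j m dm le_d; have [|g hg gE] := HF i.+1 j m dm; first by lia.
exists g => // x; rewrite (_ : s.+1 + i + j = s + i.+1 + j)%N; last by lia.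
rewrite -gE; congr (gauss (_ * _)).
by rewrite mulnS exprD; ring.
Qed.

Lemma divides_degree_sqnorm s F : divides_degree s F ->
  divides_degree s.+1 (fun x => F x * scaled_sqnorm x).
Proof.
move=> HF i j m dm le_d; have [|g hg gE] := HF i j.+1 m dm; first by lia.
exists g => // x; rewrite (_ : s.+1 + i + j = s + i + j.+1)%N; last by lia.
by rewrite -gE; congr (gauss (_ * _)); rewrite exprS; ring.
Qed.

Lemma divides_degreeD s F G : divides_degree s F -> divides_degree s G ->
  divides_degree s (fun x => F x + G x).
Proof.
move=> HF HG i j m dm le_d; have [g hg gE] := HF i j m dm le_d.
have [h hh hE] := HG i j m dm le_d.
exists (g + h); first by rewrite rpredD.
by move=> x; rewrite !mulrDl gaussD gE hE mevalD mulrDr.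
Qed.

Lemma divides_degreeZ s F c : divides_degree s F ->
  divides_degree s (fun x => c *: F x).
Proof.
move=> HF i j m dm le_d; have [g hg gE] := HF i j m dm le_d.
exists (c *: g); first by rewrite rpredZ.
by move=> x; rewrite -!scalerAl gaussZ gE mevalZ mulrCA.
Qed.

Lemma eq_divides_degree s F G : (forall x, F x = G x) ->
  divides_degree s F -> divides_degree s G.
Proof.
move=> FG HF i j m dm le_d; have [g hg gE] := HF i j m dm le_d.
by exists g => // x; rewrite -FG gE.
Qed.

Lemma divides_degree_iter s F (u : ('I_n -> R) -> {mpoly R[n]}) k :
  (forall s F, divides_degree s F -> divides_degree s.+1 (fun x => F x * u x)) ->
  divides_degree s F -> divides_degree (s + k) (fun x => F x * u x ^+ k).
Proof.
move=> Hu HF; elim: k => [|k IHk].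
  by rewrite addn0; apply: eq_divides_degree HF => x; rewrite expr0 mulr1.
by rewrite addnS; apply: eq_divides_degree (Hu _ _ IHk) => x; rewrite exprSr mulrA.
Qed.

Lemma divides_degree_kernel_radial N q s F : divides_degree s F ->
  divides_degree (s + N) (fun x => F x * kernel_radial N q x).
Proof.
move=> HF.
have Hu s' F' : divides_degree s' F' ->
    divides_degree s'.+1 (fun x => F' x * (scaled_sqnorm x - lform x ^+ 2)).
  move=> HF'.
  apply: eq_divides_degree (divides_degreeD (divides_degree_sqnorm HF')
    (divides_degreeZ (-1) (divides_degree_lform HF'))) => x.
  by rewrite scaleN1r mulrBr.
have Hk (k : 'I_N.+1) : divides_degree (s + N) (fun x => q k *:
    (F x * (scaled_sqnorm x - lform x ^+ 2) ^+ k * scaled_sqnorm x ^+ (N - k))).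
  apply: divides_degreeZ.
  have -> : (s + N = s + k + (N - k))%N by have := ltn_ord k; lia.
  by apply: divides_degree_iter divides_degree_sqnorm _; apply: divides_degree_iter.
apply: (@eq_divides_degree _ (fun x => \sum_(k < N.+1) q k *:
    (F x * (scaled_sqnorm x - lform x ^+ 2) ^+ k * scaled_sqnorm x ^+ (N - k)))) => [x|].
  by rewrite /kernel_radial mulr_sumr; apply: eq_bigr => k _; rewrite -scalerAr mulrA.
elim: (index_enum _) => [|k r IHr].
  move=> i j m dm le_d; exists 0; first exact: dhomog0.
  by move=> x; rewrite big_nil !mul0r linear0 meval0 mulr0.
apply: eq_divides_degree (divides_degreeD (Hk k) IHr) => x.
by rewrite big_cons.
Qed.

Lemma kernel_root_divides N e q :
  divides_degree (2 * N + e) (fun x => kernel_root N e q x ^+ 2).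
Proof.
have H := divides_degree_kernel_radial (N := N) q (divides_degree_kernel_radial (N := N) q
  (divides_degree_iter (k := e) divides_degree_lform divides_degree1)).
rewrite (_ : 2 * N + e = 0 + e + N + N)%N; last by lia.
apply: eq_divides_degree H => x.
by rewrite /kernel_root mul1r -exprM mulnC exprM exprMn -mulrA -expr2.
Qed.

(** The integral of the kernel against a form of degree 2d is divisible by the
    power of |x|^2 that leaves a form of degree 2d. *)
Lemma kernel_operator N e q : (d <= 2 * N + e)%N ->
  exists T : {linear {mpoly R[n]} -> {mpoly R[n]}},
    (forall f, f \is (2 * d).-homog -> T f \is (2 * d).-homog) /\
    (forall f x, f \is (2 * d).-homog ->
       gauss (kernel_root N e q x ^+ 2 * f)
         = (sqnorm R n).@[x] ^+ (2 * N + e - d) * (T f).@[x]).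
Proof.
move=> le_d.
have /choice [G GP] : forall m : 'X_{1..n}, exists g : {mpoly R[n]},
   mdeg m = (2 * d)%N -> g \is (2 * d).-homog /\
    forall x, gauss (kernel_root N e q x ^+ 2 * 'X_[m])
              = (sqnorm R n).@[x] ^+ (2 * N + e - d) * g.@[x].
  move=> m; case: (mdeg m =P (2 * d)%N) => [dm|ndm]; last by exists 0 => /ndm.
  have [|g hg gE] := @kernel_root_divides N e q 0%N 0%N m dm; first by rewrite !addn0.
  exists g => _; split=> // x.
  by have := gE x; rewrite !expr0 !mulr1 !addn0.
exists (linext G : {linear _ -> _}); split=> [f hf|f x hf].
  rewrite /= /linext; apply: rpred_sum => m _.
  case: (eqVneq (mdeg m) (2 * d)%N) => [dm|ndm].
    by rewrite rpredZ //; case: (GP m dm).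
  by rewrite (dhomog_nemf_coeff hf ndm) scale0r dhomog0.
have -> : (linext G f).@[x] = \sum_(m <- msupp f) f@_m * (G m).@[x].
  rewrite /linext (raddf_sum (meval x)); apply: eq_bigr => m _ /=.
  by rewrite mevalZ.
rewrite gauss_mulE mulr_sumr.
apply: eq_big_seq => m m_f /=.
have dm : mdeg m = (2 * d)%N by move: m m_f; apply: dhomog_mf hf.
by rewrite (GP m dm).2 mulrCA.
Qed.

End Divisibility.

(** * The maximum norm and the inverse of the operator *)

Section SphereNorm.
Variables (R : realType) (n : nat).

Lemma unit_sphereE (u : 'rV[R]_n) : unit_sphere u <-> (sqnorm R n).@[u 0] = 1.
Proof.
rewrite meval_sqnorm /unit_sphere /norm2 /=; split => [u1|->]; last exact: sqrtr1.
by rewrite -[LHS]sqr_sqrtr ?u1 ?expr1n // sumr_ge0 // => i _; apply: sqr_ge0.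
Qed.

Lemma meval_sphere_bound (p : {mpoly R[n]}) x : (sqnorm R n).@[x] = 1 ->
  `|p.@[x]| <= \sum_(m <- msupp p) `|p@_m|.
Proof.
move=> x1; rewrite mevalE (le_trans (ler_norm_sum _ _ _)) //.
apply: ler_sum => m _; rewrite normrM ler_piMr // normr_prod.
have xi i : `|x i| <= 1.
  rewrite -(@ler_pXn2r _ 2) ?nnegrE // expr1n real_normK ?num_real //.
  rewrite -x1 meval_sqnorm (bigD1 i) //= lerDl.
  by apply: sumr_ge0 => j _; apply: sqr_ge0.
apply: prodr_ile1 => i _; rewrite normr_ge0 normrX /=.
by rewrite exprn_ile1.
Qed.

Variable e : nat.
Implicit Type f : dhomog n R e.

Lemma ler_sphere_norm f x : (sqnorm R n).@[x] = 1 ->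
  `|(f : {mpoly R[n]}).@[x]| <= sphere_norm f.
Proof.
move=> x1; apply: sup_upper_bound; last first.
  exists (\row_i x i).
    by apply/unit_sphereE; rewrite -x1; apply: meval_eq => i; rewrite mxE.
  by congr `|_|; apply: meval_eq => i; rewrite mxE.
split.
  exists `|(f : {mpoly R[n]}).@[x]|; exists (\row_i x i).
    by apply/unit_sphereE; rewrite -x1; apply: meval_eq => i; rewrite mxE.
  by congr `|_|; apply: meval_eq => i; rewrite mxE.
exists (\sum_(m <- msupp (f : {mpoly R[n]})) `|(f : {mpoly R[n]})@_m|).
move=> _ [u /unit_sphereE u1 <-].
exact: meval_sphere_bound.
Qed.

Lemma unit_vector_exists : (0 < n)%N -> exists x : 'I_n -> R, (sqnorm R n).@[x] = 1.
Proof.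
move=> n0; exists (fun i => (i == Ordinal n0)%:R).
rewrite meval_sqnorm (bigD1 (Ordinal n0)) //= ?eqxx expr1n big1 ?addr0 // => j /negPf ->.
by rewrite expr0n.
Qed.

Lemma sphere_norm_le f B : (0 < n)%N ->
  (forall x, (sqnorm R n).@[x] = 1 -> `|(f : {mpoly R[n]}).@[x]| <= B) ->
  sphere_norm f <= B.
Proof.
move=> n0 fB; apply: sup_le_ub => [|_ [u /unit_sphereE u1 <-]]; last exact: fB.
have [x x1] := unit_vector_exists n0.
exists `|(f : {mpoly R[n]}).@[x]|; exists (\row_i x i).
  by apply/unit_sphereE; rewrite -x1; apply: meval_eq => i; rewrite mxE.
by congr `|_|; apply: meval_eq => i; rewrite mxE.
Qed.

Lemma sphere_norm_ge0 f : (0 < n)%N -> 0 <= sphere_norm f.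
Proof.
move=> n0; have [x x1] := unit_vector_exists n0.
exact: le_trans (ler_sphere_norm f x1).
Qed.

Lemma sphere_norm_eq0 f : (0 < n)%N -> (0 < e)%N -> sphere_norm f = 0 -> f = 0.
Proof.
move=> n0 e0 f0; apply: val_inj; apply: (homog_sphere0 e0 (valP f)) => u u1.
by apply/eqP; rewrite -normr_eq0 eq_le normr_ge0 -f0 ler_sphere_norm.
Qed.

End SphereNorm.

Lemma linear_inj_surj (R : fieldType) (V : vectType R) (L : {linear V -> V}) :
  (forall v, L v = 0 -> v = 0) -> forall w, exists v, L v = w.
Proof.
move=> Linj w; pose l := linfun L.
have k0 : lker l == 0%VS.
  apply/lker0P => u v; rewrite !lfunE => uv; apply/eqP; rewrite -subr_eq0.
  by apply/eqP/Linj; rewrite linearB /= uv subrr.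
exists ((l^-1)%VF w); rewrite -(lfunE L) -/l lker0_lfunVK //.
Qed.

Section Solve.
Variables (R : realType) (n' d : nat).
Let n := n'.+1.
Hypothesis d_gt0 : (0 < d)%N.
Local Notation V := (dhomog n'.+1 R (2 * d)).
Variable T : {linear {mpoly R[n'.+1]} -> {mpoly R[n'.+1]}}.
Hypothesis T_homog : forall f, f \is (2 * d).-homog -> T f \is (2 * d).-homog.

Definition homog_op (f : V) : V := DHomog (T_homog (valP f)).

Lemma homog_op_linear : linear homog_op.
Proof. by move=> c f g; apply: val_inj; rewrite /= linearP. Qed.

HB.instance Definition _ := GRing.isLinear.Build R V V *:%R homog_op homog_op_linear.

(** Up to the factor c0, T differs from the identity by at most 1/2 in norm. So it
    is injective, hence onto in finite dimension, and the norm of g is at most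
    twice that of f. *)
Lemma homog_op_solve (c0 c1 : R) : 0 < c0 -> 2 * c1 <= c0 ->
  (forall (f : V) x, (sqnorm R n).@[x] = 1 ->
     `|(T f).@[x] - c0 * (f : {mpoly R[n]}).@[x]| <= c1 * sphere_norm f) ->
  forall f : V, exists2 g : V, T g = c0 *: (f : {mpoly R[n]}) &
    forall x, (sqnorm R n).@[x] = 1 ->
      `|(g : {mpoly R[n]}).@[x] - (f : {mpoly R[n]}).@[x]| <= 2 * (c1 / c0) * sphere_norm f.
Proof.
move=> c0_gt0 c1c0 est f.
have n0 : (0 < n)%N by [].
have c1_ge0 : 0 <= c1 * sphere_norm f.
  have [x x1] := unit_vector_exists R n0.
  exact: le_trans (est f x x1).
(* T being close to c0, a bound on T g bounds g *)
have norm_le (g : V) (B : R) : (forall x, (sqnorm R n).@[x] = 1 -> `|(T g).@[x]| <= c0 * B) ->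
    sphere_norm g <= 2 * B.
  move=> TB.
  have : sphere_norm g <= B + 2^-1 * sphere_norm g.
    apply: sphere_norm_le => // x x1.
    rewrite -(ler_pM2l c0_gt0).
    have -> : c0 * `|(g : {mpoly R[n]}).@[x]| = `|c0 * (g : {mpoly R[n]}).@[x]|.
      by rewrite normrM gtr0_norm.
    have h1 := TB x x1; have h2 := est g x x1; have s0 := sphere_norm_ge0 g n0.
    have h3 : c1 * sphere_norm g <= c0 * (2^-1 * sphere_norm g).
      by rewrite mulrA ler_wpM2r //; lra.
    rewrite mulrDr.
    have -> : c0 * (g : {mpoly R[n]}).@[x]
      = (T g).@[x] - ((T g).@[x] - c0 * (g : {mpoly R[n]}).@[x]) by ring.
    rewrite (le_trans (ler_normB _ _)) // lerD // (le_trans h2) //.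
  by lra.
have inj (g : V) : homog_op g = 0 -> g = 0.
  move=> g0; apply: sphere_norm_eq0 => //; first by rewrite muln_gt0.
  apply/eqP; rewrite eq_le sphere_norm_ge0 // andbT -[leRHS](mulr0 2).
  apply: norm_le => x x1.
  have -> : T g = 0 by have := congr1 val g0.
  by rewrite meval0 normr0 mulr0.
have [g gf] := linear_inj_surj inj (c0 *: f).
have TgE : T g = c0 *: (f : {mpoly R[n]}) by have := congr1 val gf.
exists g => // x x1.
have gf2 : sphere_norm g <= 2 * sphere_norm f.
  apply: norm_le => y y1; rewrite TgE mevalZ normrM gtr0_norm //.
  by rewrite ler_pM2l // ler_sphere_norm.
have := est g x x1; rewrite TgE mevalZ -mulrBr normrM gtr0_norm // distrC => h.
rewrite -(ler_pM2l c0_gt0) (le_trans h) //.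
have -> : c0 * (2 * (c1 / c0) * sphere_norm f) = c1 * (2 * sphere_norm f).
  by field; rewrite lt0r_neq0.
case: (leP 0 c1) => c1s; first by rewrite ler_wpM2l.
have s0 := sphere_norm_ge0 f n0; have s1 := sphere_norm_ge0 g n0.
have f0 : sphere_norm f = 0 by nra.
by rewrite f0 mulr0 mulr0; nra.
Qed.

End Solve.

(** * The approximating measure *)

Section Measure.
Variables (R : realType) (n' d N e : nat) (q : nat -> R).
Local Notation n := n'.+1.
Local Notation r := (2 * N + e)%N.
Local Notation kernel_sq_moment i := (\sum_(k < N.+1) \sum_(l < N.+1)
  q k * q l * beta ((n%:R - 1) / 2) (n%:R / 2 + e%:R) (k + l + i)).
Hypotheses (d_gt0 : (0 < d)%N) (le_d : (d <= r)%N) (q0 : q 0%N = 1).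
Variable K : R.
Hypothesis KP : forall (f : {mpoly R[n]}) (B : R) (x y : 'I_n -> R),
    f \is (2 * d).-homog -> (sqnorm R n).@[x] = 1 ->
    (forall u, (sqnorm R n).@[u] = 1 -> `|f.@[u]| <= B) ->
    `|(f.@[y] + f.@[fun i => 2 * (lform x).@[y] * x i - y i]) / 2
        - (sqnorm R n).@[y] ^+ d * f.@[x]|
      <= K * B * ((perp x).@[y] * (sqnorm R n).@[y] ^+ d.-1).
Hypothesis ratio : 2 * (K * kernel_sq_moment 1) <= kernel_sq_moment 0.
Variable ell : {linear {mpoly R[n]} -> R^o}.
Hypothesis ell_ge0 : forall g, g \is r.-homog -> 0 <= ell (g ^+ 2).
Hypothesis ell_mass : ell (sqnorm R n ^+ r) = 1.

(** The measure lives on the quadrature nodes y_j, projected on the sphere, with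
    weights proportional to the value of ell at the square K(.,y_j). If
    T g = c0 f, applying ell to the quadrature formula for T g expresses the
    functional at f as the integral of g. *)
Lemma kernel_measure : exists (I : finType) (w : I -> R) (u : I -> 'I_n -> R),
  [/\ forall j, 0 <= w j, \sum_j w j = 1, forall j, (sqnorm R n).@[u j] = 1 &
   forall f : dhomog n R (2 * d),
     `|ell (sqnorm R n ^+ (r - d) * (f : {mpoly R[n]}))
        - \sum_j w j * (f : {mpoly R[n]}).@[u j]|
      <= 2 * (K * kernel_sq_moment 1 / kernel_sq_moment 0) * sphere_norm f].
Proof.
have n0 : (0 < n)%N by [].
have [x0 x01] := unit_vector_exists R n0.
pose C := radial_const R n e (2 * N + d).
have C0 : 0 < C by apply: radial_const_gt0.
pose c0 := C * kernel_sq_moment 0.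
have I0 : 0 < kernel_sq_moment 0 := kernel_sq_moment0_gt0 N e n0 x01 q0.
have c0_gt0 : 0 < c0 by rewrite mulr_gt0.
have [T [T_homog TE]] := @kernel_operator R n d N e q le_d.
have est (f : dhomog n R (2 * d)) x : (sqnorm R n).@[x] = 1 ->
     `|(T f).@[x] - c0 * (f : {mpoly R[n]}).@[x]|
       <= C * (K * kernel_sq_moment 1) * sphere_norm f.
  move=> x1; have := TE f x (valP f); rewrite x1 expr1n mul1r => <-.
  have := kernel_estimate N e q n0 d_gt0 (valP f) x1
    (fun y => KP y (valP f) x1 (fun u u1 => ler_sphere_norm f u1)).
  rewrite -/C -/c0 => h; apply: le_trans h _; rewrite le_eqVlt; apply/orP; left.
  by apply/eqP; ring.
have solve : forall f : dhomog n R (2 * d), exists2 g : dhomog n R (2 * d),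
    T g = c0 *: (f : {mpoly R[n]}) &
    forall x, (sqnorm R n).@[x] = 1 ->
      `|(g : {mpoly R[n]}).@[x] - (f : {mpoly R[n]}).@[x]|
        <= 2 * (K * kernel_sq_moment 1 / kernel_sq_moment 0) * sphere_norm f.
  move=> f; have [|g gE gf] := homog_op_solve d_gt0 T_homog c0_gt0 _ est f.
    by rewrite /c0 mulrCA ler_pM2l.
  exists g => // x x1; have := gf x x1.
  by rewrite /c0 -mulf_div divff ?mul1r // lt0r_neq0.
have [I [w [y [w_ge0 quad]]]] := gauss_quadrature R n (2 * r + 2 * d).+1.
(* an identity between forms in x: both sides are E_y[K(x,y) g(y)] *)
have repr (f g : dhomog n R (2 * d)) : T g = c0 *: (f : {mpoly R[n]}) ->
    c0 * ell (sqnorm R n ^+ (r - d) * (f : {mpoly R[n]}))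
      = \sum_j (w j * ell (kernel_root N e q (y j) ^+ 2)) * (g : {mpoly R[n]}).@[y j].
  move=> gf.
  have E : \sum_j (w j * (g : {mpoly R[n]}).@[y j]) *: kernel_root N e q (y j) ^+ 2
      = c0 *: (sqnorm R n ^+ (r - d) * (f : {mpoly R[n]})).
    apply/eqP; rewrite -subr_eq0; apply/eqP/mpoly_eval0 => x.
    rewrite mevalB mevalZ mevalM rmorphXn /= mulrCA -mevalZ -gf -(TE _ _ (valP g)).
    rewrite quad; last first.
      have hom : kernel_root N e q x ^+ 2 * val g \is (2 * r + 2 * d).-homog.
        apply: dhomogM; last exact: valP.
        by rewrite mulnC dhomogMn // kernel_root_homog.
      by apply/bigmax_leqP_seq => m m_in _; rewrite ltnS (dhomog_mf hom m_in).
    apply/eqP; rewrite subr_eq0; apply/eqP.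
    rewrite (raddf_sum (meval x)); apply: eq_bigr => j _ /=.
    have := kernel_root_sym N e q x (y j).
    move: (kernel_root N e q x) (kernel_root N e q (y j)) => P Q PQ.
    by rewrite mevalZ !mevalM PQ; ring.
  have := congr1 ell E; rewrite linear_sum linearZ => E2; apply: etrans (esym E2) _.
  apply: eq_bigr => j _; rewrite linearZ /=.
  by rewrite mulrAC.
pose om j := w j * ell (kernel_root N e q (y j) ^+ 2) * (sqnorm R n).@[y j] ^+ d / c0.
have [u uP] : exists u : I -> 'I_n -> R, forall j, (sqnorm R n).@[u j] = 1 /\
    forall g : {mpoly R[n]}, g \is (2 * d).-homog ->
      g.@[y j] = (sqnorm R n).@[y j] ^+ d * g.@[u j].
  have /choice [u uP] : forall j, exists u : 'I_n -> R, (sqnorm R n).@[u] = 1 /\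
    forall g : {mpoly R[n]}, g \is (2 * d).-homog ->
      g.@[y j] = (sqnorm R n).@[y j] ^+ d * g.@[u].
    move=> j; case: (eqVneq (sqnorm R n).@[y j] 0) => [yj0|yj0].
      exists x0; split=> // g hg; rewrite (meval_homog0 _ hg yj0) ?muln_gt0 //.
      by rewrite yj0 expr0n -[d]prednK // mul0r.
    have [u u1 yE] := sphere_scale yj0; exists u; split=> // g hg.
    by rewrite (meval_eq _ yE) (meval_homog _ _ hg) exprM sqr_sqrtr ?sqnorm_ge0.
  by exists u.
have repr2 (f g : dhomog n R (2 * d)) : T g = c0 *: (f : {mpoly R[n]}) ->
    ell (sqnorm R n ^+ (r - d) * (f : {mpoly R[n]}))
      = \sum_j om j * (g : {mpoly R[n]}).@[u j].
  move=> /repr E; apply: (mulfI (lt0r_neq0 c0_gt0)); rewrite E mulr_sumr.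
  apply: eq_bigr => j _; rewrite (uP j).2 ?(valP g) // /om.
  by field; rewrite lt0r_neq0.
have om_ge0 j : 0 <= om j.
  rewrite /om divr_ge0 ?(ltW c0_gt0) // mulr_ge0 ?exprn_ge0 ?sqnorm_ge0 //.
  by rewrite mulr_ge0 // ell_ge0 // kernel_root_homog.
have om1 : \sum_j om j = 1.
  (* T fixes |x|^(2d) up to c0, because it does so on the sphere *)
  have hs : sqnorm R n ^+ d \is (2 * d).-homog by rewrite dhomogMn // sqnorm_homog.
  pose s : dhomog n R (2 * d) := DHomog hs.
  have Ts : T s = c0 *: (s : {mpoly R[n]}).
    apply/eqP; rewrite -subr_eq0; apply/eqP.
    apply: (@homog_sphere0 _ _ (2 * d)); first by rewrite muln_gt0.
      by rewrite rpredB ?rpredZ // T_homog.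
    move=> x x1; have := TE s x (valP s); rewrite x1 expr1n mul1r mevalB => <-.
    rewrite mevalZ /= rmorphXn /= x1 expr1n mulr1.
    have := gauss_kernel_root_moment N e q n0 (leq0n d) x1.
    by rewrite expr0 mul1r subn0 => ->; rewrite subrr.
  have := repr2 s s Ts; rewrite /= -exprD subnK // ell_mass => ->.
  by apply: eq_bigr => j _; rewrite rmorphXn /= (uP j).1 expr1n mulr1.
exists I, om, u; split=> // [j|f]; first exact: (uP j).1.
have [g gE gf] := solve f.
rewrite (repr2 f g gE) -sumrB (le_trans (ler_norm_sum _ _ _)) //.
rewrite -[leRHS]mul1r -[X in _ <= X * _]om1 mulr_suml; apply: ler_sum => j _.
rewrite -mulrBr normrM (ger0_norm (om_ge0 j)).
by apply: ler_wpM2l => //; apply: gf; exact: (uP j).1.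
Qed.

End Measure.

(** * Tensors as functionals on forms *)

Section Tensor.
Variables (R : realType) (n' : nat).
Local Notation n := n'.+1.

Definition word_poly (s : seq 'I_n) : {mpoly R[n]} := \prod_(i <- s) 'X_i.

Lemma word_polyE s : word_poly s = 'X_[s2m s].
Proof.
elim: s => [|i s IHs].
  have -> : s2m ([::] : seq 'I_n) = 0%MM.
    by apply/mnmP => i; rewrite !mnmE.
  by rewrite /word_poly big_nil mpolyX0.
rewrite /word_poly big_cons -/(word_poly s) IHs -mpolyXD; congr 'X_[_].
by apply/mnmP => j; rewrite mnmDE mnm1E [in LHS]mnmE [in RHS]mnmE.
Qed.

Lemma word_poly_homog (s : seq 'I_n) : word_poly s \is (size s).-homog.
Proof.
elim: s => [|i s IHs]; first by rewrite /word_poly big_nil dhomog1.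
rewrite /word_poly big_cons; apply: (@dhomogM _ _ _ 1) => //.
by rewrite dhomogX /= mdeg1.
Qed.

Lemma word_poly_cat s1 s2 : word_poly (s1 ++ s2) = word_poly s1 * word_poly s2.
Proof. exact: big_cat. Qed.

(** Letters j, ..., j + k - 1 of the sorted list of the variables of m. *)
Definition mnm_word k (j : nat) (m : 'X_{1..n}) : k.-tuple 'I_n :=
  [tuple nth ord0 (m2s m) (j + x) | x < k].

Lemma mnm_word_cat k l m : mdeg m = (k + l)%N ->
  mnm_word k 0 m ++ mnm_word l k m = m2s m.
Proof.
rewrite -size_m2s => sz; apply: (@eq_from_nth _ ord0).
  by rewrite size_cat !size_tuple sz.
move=> i; rewrite size_cat !size_tuple nth_cat size_tuple => lt_i.
case: ltnP => lt_ik.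
  by rewrite -[i in LHS]/(val (Ordinal lt_ik)) -tnth_nth tnth_mktuple.
have lt_l : (i - k < l)%N by rewrite ltn_subLR.
by rewrite -[(i - k)%N]/(val (Ordinal lt_l)) -tnth_nth tnth_mktuple /= subnKC.
Qed.

Lemma mnm_word_poly k m : mdeg m = k -> word_poly (mnm_word k 0 m) = 'X_[m].
Proof.
move=> dm; have := @mnm_word_cat k 0 m; rewrite addn0 => /(_ dm).
rewrite [tval (mnm_word 0 k m)]size0nil ?size_tuple // cats0 => ->.
by rewrite word_polyE s2mK.
Qed.

Lemma perm_m2s (s : seq 'I_n) : perm_eq (m2s (s2m s)) s.
Proof.
apply/allP => i _ /=; have /mnmP/(_ i) := s2mK (s2m s).
by rewrite !mnmE => ->.
Qed.

Definition index_word d (a : 'I_(tdim n d)) : d.-tuple 'I_n := enum_val a.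

Section Functional.
Variables (r : nat) (M : tensmx R n r).
Hypothesis M_sym : max_symmetric M.

(** The functional with value M_(i,j) at x_i x_j, for words i and j of length r. To get
    the value at a monomial, its sorted word of length 2r is cut in the middle. *)
Definition tens_functional : {mpoly R[n]} -> R^o :=
  linext (fun m => entry M (mnm_word r 0 m) (mnm_word r r m) : R^o).
HB.instance Definition _ := GRing.Linear.copy tens_functional
  (linext (fun m => entry M (mnm_word r 0 m) (mnm_word r r m) : R^o)).

Lemma tens_functionalZ c p : tens_functional (c *: p) = c * tens_functional p.
Proof. exact: linearZ. Qed.
Lemma tens_functional_sum (I : Type) (s : seq I) (F : I -> {mpoly R[n]}) :
  tens_functional (\sum_(i <- s) F i) = \sum_(i <- s) tens_functional (F i).
Proof. exact: linear_sum. Qed.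

(** Maximal symmetry makes the choice of the words irrelevant. *)
Lemma tens_functionalE (i j : r.-tuple 'I_n) :
  tens_functional (word_poly i * word_poly j) = entry M i j.
Proof.
rewrite -word_poly_cat word_polyE /tens_functional linextX; set m := s2m _.
have dm : mdeg m = (r + r)%N.
  have := word_poly_homog (cat_tuple i j).
  by rewrite word_polyE dhomogX /= size_cat !size_tuple => /eqP.
have : perm_eq (mnm_word r 0 m ++ mnm_word r r m) (i ++ j).
  by rewrite mnm_word_cat // perm_m2s.
move=> /(tuple_permP (s := cat (mnm_word r 0 m) (mnm_word r r m)) (t := cat_tuple i j)) [s sE].
by apply: (M_sym (s := s)); apply: val_inj.
Qed.

(** If v is the vector of coefficients of g on words, the value at g^2 is v^T M v. *)
Lemma tens_functional_sq_ge0 g : psdmx M -> g \is r.-homog ->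
  0 <= tens_functional (g ^+ 2).
Proof.
move=> [_ M_ge0] hg.
pose v : 'cV[R]_(tdim n r) :=
  \sum_(m <- msupp g) g@_m *: delta_mx (enum_rank (mnm_word r 0 m)) 0.
suff -> : tens_functional (g ^+ 2) = (v^T *m M *m v) 0 0 by apply: M_ge0.
have gE : g = \sum_(m <- msupp g) g@_m *: word_poly (mnm_word r 0 m).
  rewrite {1}(mpolyE g); apply: eq_big_seq => m m_g.
  by rewrite mnm_word_poly //; move: m m_g; apply: dhomog_mf hg.
have -> : g ^+ 2 = \sum_(m <- msupp g) \sum_(m' <- msupp g)
   (g@_m * g@_m') *: (word_poly (mnm_word r 0 m) * word_poly (mnm_word r 0 m')).
  rewrite expr2 {1 2}gE big_distrl; apply: eq_bigr => m _ /=.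
  rewrite big_distrr; apply: eq_bigr => m' _ /=.
  by rewrite -scalerAl -scalerAr scalerA.
have -> : v^T = \sum_(m <- msupp g) g@_m *: delta_mx 0 (enum_rank (mnm_word r 0 m)).
  rewrite /v (raddf_sum (@trmx _ _ _)); apply: eq_bigr => m _ /=.
  by rewrite linearZ /= trmx_delta.
rewrite tens_functional_sum mulmx_suml mulmx_suml summxE.
apply: eq_bigr => m _; rewrite tens_functional_sum /v mulmx_sumr summxE.
apply: eq_bigr => m' _; rewrite tens_functionalZ tens_functionalE.
rewrite -!scalemxAl -scalemxAr -rowE -colE !mxE /=.
by rewrite mulrA.
Qed.

Lemma sqnorm_expE s : sqnorm R n ^+ s = \sum_(k : s.-tuple 'I_n) word_poly k * word_poly k.
Proof.
rewrite /sqnorm -[s in LHS]card_ord -prodr_const.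
rewrite (bigA_distr_bigA (fun (_ : 'I_s) (j : 'I_n) => 'X_j ^+ 2 : {mpoly R[n]})) /=.
rewrite (reindex (fun t : s.-tuple 'I_n => [ffun x => tnth t x])) /=.
  apply: eq_bigr => t _; rewrite -big_split /= big_tuple; apply: eq_bigr => x _.
  by rewrite ffunE expr2.
apply: onW_bij; exists (fun f : {ffun 'I_s -> 'I_n} => [tuple f x | x < s]) => [t|f].
  by apply: eq_from_tnth => x; rewrite tnth_mktuple ffunE.
by apply/ffunP => x; rewrite ffunE tnth_mktuple.
Qed.

Lemma tens_functional_trace : tens_functional (sqnorm R n ^+ r) = \tr M.
Proof.
rewrite sqnorm_expE tens_functional_sum /mxtrace (reindex enum_rank) /=; last first.
  by apply: onW_bij; apply: enum_rank_bij.
by apply: eq_bigr => k _; rewrite tens_functionalE.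
Qed.

(** Expanding |x|^(2(r-d)) over words of length r - d produces the sum in the
    partial trace. *)
Lemma tens_functional_partial_trace d (le_dr : (d <= r)%N) (a b : 'I_(tdim n d)) :
  tens_functional (sqnorm R n ^+ (r - d)
      * (word_poly (index_word a) * word_poly (index_word b)))
   = partial_trace le_dr M a b.
Proof.
rewrite sqnorm_expE mulr_suml tens_functional_sum mxE; apply: eq_bigr => k _ /=.
rewrite -tens_functionalE; congr tens_functional.
by rewrite !val_tcast /= !word_poly_cat; ring.
Qed.

End Functional.

Lemma tens_monomialE d (a b : 'I_(tdim n d)) :
  (tens_monomial R a b : {mpoly R[n]})
    = word_poly (index_word a) * word_poly (index_word b) :> {mpoly R[n]}.
Proof.
by rewrite /= mxE big_ord1 !mxE /word_poly !big_tuple.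
Qed.

Lemma tens_projE d (u : 'I_n -> R) (a b : 'I_(tdim n d)) :
  tens_proj d u a b = (word_poly (index_word a) * word_poly (index_word b)).@[u].
Proof.
rewrite mxE big_ord1 !mxE mevalM /word_poly !big_tuple !rmorph_prod /=.
by congr (_ * _); apply: eq_bigr => i _; rewrite mevalXU.
Qed.

(** Every monomial of degree 2d occurs among the entries of the tensor. *)
Lemma represents_unique d (L : {scalar dhomog n R (2 * d)}) (A : tensmx R n d)
    (phi : {linear {mpoly R[n]} -> R^o}) :
  represents L A ->
  (forall a b, phi (word_poly (index_word a) * word_poly (index_word b)) = A a b) ->
  forall f : dhomog n R (2 * d), L f = phi f.
Proof.
move=> LA phiA f.
have hX m : mdeg m = (2 * d)%N -> L (insubd 0 'X_[m]) = phi 'X_[m].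
  move=> dm; have dm2 : mdeg m = (d + d)%N by rewrite dm mul2n addnn.
  pose a := enum_rank (mnm_word d 0 m); pose b := enum_rank (mnm_word d d m).
  have E : 'X_[m] = word_poly (index_word a) * word_poly (index_word b).
    by rewrite /index_word !enum_rankK -word_poly_cat mnm_word_cat // word_polyE s2mK.
  have -> : insubd 0 'X_[m] = tens_monomial R a b :> dhomog n R (2 * d).
    apply: val_inj; rewrite val_insubd dhomogX /= dm eqxx.
    by rewrite E -tens_monomialE.
  by rewrite LA E phiA.
have fE : f = \sum_(m <- msupp f) (f : {mpoly R[n]})@_m *: insubd 0 'X_[m].
  apply: val_inj; rewrite raddf_sum /= {1}(mpolyE f); apply: eq_big_seq => m m_f /=.
  rewrite val_insubd dhomogX /=; have -> : mdeg m = (2 * d)%N.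
    by move: m m_f; apply: dhomog_mf (valP f).
  by rewrite eqxx.
rewrite {1}fE linear_sum /= [in RHS](mpolyE f) linear_sum /=.
apply: eq_big_seq => m m_f; rewrite !linearZ /= hX //.
by move: m m_f; apply: dhomog_mf (valP f).
Qed.

Section Restrict.
Variables (d : nat) (phi : {linear {mpoly R[n]} -> R^o}).
Definition homog_restrict (f : dhomog n R (2 * d)) : R := phi f.
Lemma homog_restrict_scalar : scalar homog_restrict.
Proof. by move=> c f g; rewrite /homog_restrict linearP. Qed.
HB.instance Definition _ := GRing.isLinear.Build R (dhomog n R (2 * d)) R *%R
  homog_restrict homog_restrict_scalar.

Lemma homog_restrict_represents (A : tensmx R n d) :
  (forall a b, phi (word_poly (index_word a) * word_poly (index_word b)) = A a b) ->
  represents (homog_restrict : {scalar _}) A.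
Proof. by move=> phiA a b; rewrite -phiA -tens_monomialE. Qed.
End Restrict.

End Tensor.

(** * The Schatten norm and the norm F1 *)

Section Norms.
Variable R : realType.

Lemma mup_prod_XsubC m (D : 'I_m -> R) a :
  mup a (\prod_j ('X - (D j)%:P)) = (\sum_j (D j == a))%N.
Proof.
suff [] : (\prod_j ('X - (D j)%:P) != 0) /\
  (mup a (\prod_j ('X - (D j)%:P)) = \sum_j (D j == a))%N by [].
elim/big_rec2: _ => [|j k p _ [p0 <-]]; first by rewrite oner_eq0 mupNroot // root1.
have XD0 : 'X - (D j)%:P != 0 by rewrite polyXsubC_eq0.
split; first by rewrite mulf_neq0.
by rewrite mupM // -[X in mup _ X]expr1 mup_XsubCX; case: eqP.
Qed.


Lemma schatten1_symE m (A : 'M[R]_m) (D : 'I_m -> R) :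
  char_poly A = \prod_j ('X - (D j)%:P) -> schatten1_sym A = \sum_j `|D j|.
Proof.
move=> AD; have p0 : char_poly A != 0 by rewrite monic_neq0 // char_poly_monic.
rewrite /schatten1_sym; set p := char_poly A in AD p0 *.
under eq_bigr => a _ do rewrite AD mup_prod_XsubC -sumrMnr.
rewrite exchange_big /=; apply: eq_bigr => j _.
have Dj : D j \in rootsR p.
  rewrite -(roots_on_rootsR p0) in_itv /= AD /root horner_prod (bigD1 j) //=.
  by rewrite !hornerE subrr mul0r.
rewrite (bigD1_seq (D j)) ?uniq_roots //= eqxx mulr1n big1 ?addr0 // => a aD.
by rewrite eq_sym (negPf aD) mulr0n.
Qed.

End Norms.

Section NormF1.
Variables (R : realType) (n' d : nat).
Local Notation n := n'.+1.
Variable phi : {linear {mpoly R[n]} -> R^o}.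
Variable A : tensmx R n d.
Hypothesis phiA : forall a b,
  phi (word_poly R (index_word a) * word_poly R (index_word b)) = A a b.
Variable B : R.
Hypothesis phiB : forall f : dhomog n R (2 * d),
  `|phi (f : {mpoly R[n]})| <= B * sphere_norm f.

Local Notation F1set := [set y | exists (L : {scalar dhomog n R (2 * d)})
                      (f : dhomog n R (2 * d)),
         [/\ represents L A, sphere_norm f = 1 & y = L f]].

Lemma F1set_ubound : ubound F1set B.
Proof.
move=> _ [L [f [LA f1 ->]]]; rewrite (represents_unique LA phiA).
by rewrite (le_trans (ler_norm _)) // (le_trans (phiB f)) // f1 mulr1.
Qed.

Lemma sphere_normZ c (f : dhomog n R (2 * d)) :
  sphere_norm (c *: f) = `|c| * sphere_norm f.
Proof.
have le c' (g : dhomog n R (2 * d)) : sphere_norm (c' *: g) <= `|c'| * sphere_norm g.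
  apply: sphere_norm_le => // x x1; rewrite mevalZ normrM ler_wpM2l //.
  exact: ler_sphere_norm.
apply/eqP; rewrite eq_le le /=; case: (eqVneq c 0) => [->|c0].
  by rewrite normr0 mul0r sphere_norm_ge0.
have := le c^-1 (c *: f); rewrite scalerA mulVf // scale1r => h.
by rewrite -ler_pdivlMl ?normr_gt0 // -normfV.
Qed.

Lemma F1set_mem (f : dhomog n R (2 * d)) : sphere_norm f = 1 -> F1set (phi (f : {mpoly R[n]})).
Proof.
move=> f1; exists (homog_restrict phi : {scalar dhomog n R (2 * d)}), f.
by split=> //; apply: homog_restrict_represents.
Qed.

Lemma sphere_norm_sqnorm : exists h : dhomog n R (2 * d), sphere_norm h = 1.
Proof.
have hs : sqnorm R n ^+ d \is (2 * d).-homog by rewrite dhomogMn // sqnorm_homog.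
exists (DHomog hs); apply/eqP; rewrite eq_le; apply/andP; split.
  by apply: sphere_norm_le => // x x1; rewrite /= rmorphXn /= x1 expr1n normr1.
have [//|x x1] := unit_vector_exists R (n := n).
by have := ler_sphere_norm (DHomog hs) x1; rewrite /= rmorphXn /= x1 expr1n normr1.
Qed.

Lemma normF1_le : normF1 A <= B.
Proof.
have [h h1] := sphere_norm_sqnorm.
by apply: sup_le_ub F1set_ubound; exists (phi h); apply: F1set_mem.
Qed.

(** Divide f by its norm. If the norm is zero the value is zero, and the supremum
    is nonnegative because the unit sphere of forms is symmetric. *)
Lemma phi_le_normF1 (f : dhomog n R (2 * d)) : sphere_norm f <= 1 ->
  phi (f : {mpoly R[n]}) <= normF1 A.
Proof.
move=> f1; have [h h1] := sphere_norm_sqnorm.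
have sup_ub := @sup_upper_bound _ F1set.
have hs : has_sup F1set.
  split; last by exists B; apply: F1set_ubound.
  by exists (phi h); apply: F1set_mem.
have ge0 : 0 <= normF1 A.
  case: (leP 0 (phi (h : {mpoly R[n]}))) => h0.
    by apply: le_trans h0 _; apply: sup_ub => //; apply: F1set_mem.
  have Nh1 : sphere_norm (- h) = 1 by rewrite -scaleN1r sphere_normZ normrN1 mul1r.
  apply: le_trans (_ : phi (- h : {mpoly R[n]}) <= _).
    by rewrite linearN oppr_ge0 ltW.
  by apply: sup_ub => //; exact: (F1set_mem Nh1).
case: (ltP 0 (phi (f : {mpoly R[n]}))) => [f_gt0|]; last by move=> le0; apply: le_trans ge0.
have s0 : 0 < sphere_norm f.
  rewrite lt_neqAle sphere_norm_ge0 // andbT eq_sym.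
  apply: contraTneq f_gt0 => f0; rewrite -leNgt (le_trans (ler_norm _)) //.
  by rewrite (le_trans (phiB f)) // f0 mulr0.
set s := sphere_norm f in f1 s0.
have sf : sphere_norm (s^-1 *: f) = 1.
  by rewrite sphere_normZ normfV gtr0_norm // mulVf // lt0r_neq0.
apply: le_trans (_ : phi (s^-1 *: (f : {mpoly R[n]})) <= _).
  by rewrite linearZ /= [leRHS]mulrC ler_pdivlMr // ler_piMr // ltW.
by apply: sup_ub => //; exact: (F1set_mem sf).
Qed.

(** Take f = v^T S v for v the d-th tensor power of x and S the matrix sign of A.
    The functional at f is tr(A S), the sum of the absolute eigenvalues, and
    |f| <= |v|^2 = 1 on the sphere. *)
Lemma schatten1_le_normF1 : schatten1_sym A <= normF1 A.
Proof.
have Asym : A^T = A.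
  by apply/matrixP => a b; rewrite mxE -!phiA mulrC.
have [D [E [AD AE sumE E_ge0 trE]]] := spectral_resolution Asym.
rewrite (schatten1_symE AD).
pose S := \sum_j Num.sg (D j) *: E j.
pose f : dhomog n R (2 * d) := \sum_a \sum_b S b a *: tens_monomial R a b.
have vf : (f : {mpoly R[n]}) = \sum_a \sum_b S b a *:
     (word_poly R (index_word a) * word_poly R (index_word b)).
  rewrite /f raddf_sum; apply: eq_bigr => a _ /=.
  rewrite raddf_sum; apply: eq_bigr => b _ /=.
  by rewrite -tens_monomialE.
have -> : \sum_j `|D j| = phi (f : {mpoly R[n]}).
  rewrite vf linear_sum.
  transitivity (\tr (A *m S)).
    rewrite /S mulmx_sumr linear_sum; apply: eq_bigr => j _ /=.
    by rewrite normrEsg -scalemxAr AE !linearZ /= trE mulr1.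
  apply: eq_bigr => a _; rewrite mxE linear_sum; apply: eq_bigr => b _ /=.
  by rewrite linearZ phiA mulrC.
apply: phi_le_normF1; apply: sphere_norm_le => // x x1.
pose v : 'cV[R]_(tdim n d) := \col_a (word_poly R (index_word a)).@[x].
have -> : (f : {mpoly R[n]}).@[x] = (v^T *m S *m v) 0 0.
  rewrite vf mxE (raddf_sum (meval x)); apply: eq_bigr => a _ /=.
  rewrite (raddf_sum (meval x)) mxE mulr_suml; apply: eq_bigr => b _ /=.
  by rewrite mevalZ mevalM !mxE; ring.
have vv : (v^T *m v) 0 0 = 1.
  have : (sqnorm R n ^+ d).@[x] = 1 by rewrite rmorphXn /= x1 expr1n.
  rewrite sqnorm_expE (raddf_sum (meval x)) => <-.
  rewrite mxE (reindex enum_rank) /=; last by apply: onW_bij; apply: enum_rank_bij.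
  by apply: eq_bigr => k _; rewrite !mxE mevalM /index_word enum_rankK.
have vEv : \sum_j (v^T *m E j *m v) 0 0 = 1.
  by rewrite -vv -{2}[v^T]mulmx1 -sumE mulmx_sumr mulmx_suml summxE.
rewrite -[leRHS]vEv /S mulmx_sumr mulmx_suml summxE.
rewrite (le_trans (ler_norm_sum _ _ _)) //; apply: ler_sum => j _.
have -> : (v^T *m (Num.sg (D j) *: E j) *m v) 0 0 = Num.sg (D j) * (v^T *m E j *m v) 0 0.
  by rewrite -scalemxAr -scalemxAl [LHS]mxE.
rewrite normrM (ger0_norm (E_ge0 j v)).
rewrite ler_piMl //; case: sgrP => _; rewrite ?normr0 ?normrN1 ?normr1 //.
Qed.

End NormF1.

(** * Partial traces near the convex hull *)

Section Defect.
Variables (R : realType) (n s : nat) (ell : {linear {mpoly R[n]} -> R^o}).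
Variables (I : finType) (w : I -> R) (u : I -> 'I_n -> R).

(** The functional represented by the partial trace, for s = r - d, minus the
    convex combination of the points u j with weights w j. *)
Definition defect (p : {mpoly R[n]}) : R^o :=
  ell (sqnorm R n ^+ s * p) - \sum_j w j * p.@[u j].

Lemma defect_linear : linear defect.
Proof.
move=> c p g; rewrite /defect mulrDr -scalerAr linearP.
under eq_bigr => j _ do rewrite mevalD mevalZ mulrDr mulrCA.
by rewrite big_split /= -mulr_sumr scalerBr opprD addrACA.
Qed.

HB.instance Definition _ := GRing.isLinear.Build R {mpoly R[n]} R^o *:%R defect defect_linear.
End Defect.

Section Convex.
Variables (R : realType) (n d : nat).

Lemma Cd_conv (I : finType) (w : I -> R) (u : I -> 'I_n -> R) :
  (forall j, 0 <= w j) -> \sum_j w j = 1 -> (forall j, (sqnorm R n).@[u j] = 1) ->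
  Cd n d (\sum_j w j *: tens_proj d (u j)).
Proof.
move=> w0 w1 u1.
exists #|I|, (fun k => w (enum_val k)), (fun k => tens_proj d (u (enum_val k))).
split=> //.
- rewrite -w1 [RHS](reindex (enum_val : 'I_#|I| -> I)) //=.
  by apply: onW_bij; apply: enum_val_bij.
- move=> k; exists (\row_i u (enum_val k) i).
    apply/unit_sphereE; rewrite -(u1 (enum_val k)).
    by apply: meval_eq => i; rewrite mxE.
  by congr tens_proj; apply/funext => i; rewrite mxE.
- by rewrite [LHS](reindex (enum_val : 'I_#|I| -> I)) //=; apply: onW_bij; apply: enum_val_bij.
Qed.

End Convex.

(** The product on the left of I0 is at most 3n^2/4, and r is at most three times
    its integer half. *)
Lemma kernel_ratio (R : realType) (n r : nat) (I0 I1 : R) :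
  (0 < n)%N -> (1 < r)%N -> 0 <= I1 -> 0 < I0 ->
  2 * (r./2)%:R ^+ 2 * I1 <= (n%:R - 1) / 2 * ((n%:R - 1) / 2 + 2) * I0 ->
  I1 / I0 <= 4 * (n%:R ^+ 2 / r%:R ^+ 2).
Proof.
move=> n0 r1 I1_ge0 I0_gt0 h.
have r0 : 0 < r%:R :> R by rewrite ltr0n ltnW.
rewrite mulrA ler_pdivrMr // mulrAC ler_pdivlMr ?exprn_gt0 //.
have n1 : 1 <= n%:R :> R by rewrite ler1n.
have rN : r%:R <= 3 * (r./2)%:R :> R.
  rewrite -natrM ler_nat; have := odd_double_half r; case: (odd r); lia.
have rr : r%:R ^+ 2 <= 9 * (r./2)%:R ^+ 2 :> R.
  have -> : 9 * (r./2)%:R ^+ 2 = (3 * (r./2)%:R) ^+ 2 :> R by ring.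
  by rewrite lerXn2r ?nnegrE ?mulr_ge0 // ltW.
have h1 : I1 * r%:R ^+ 2 <= 9 * (I1 * (r./2)%:R ^+ 2).
  by rewrite [leRHS]mulrCA ler_wpM2l.
have h2 : (n%:R - 1) / 2 * ((n%:R - 1) / 2 + 2) * I0 <= (3 / 4) * n%:R ^+ 2 * I0.
  rewrite ler_wpM2r ?(ltW I0_gt0) //; nra.
have h3 : 0 <= n%:R ^+ 2 * I0 by rewrite mulr_ge0 ?exprn_ge0 // ltW.
apply: le_trans h1 _; lra.
Qed.

Theorem theorem3p1 (R : realType) (d : nat) (d_ge1 : (1 <= d)%N) :
  exists c c' : R, [/\ 0 < c, 0 < c' &
    forall (n r : nat) (n_ge1 : (1 <= n)%N) (le_dr : (d <= r)%N)
      (M : tensmx R n r),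
      max_symmetric M -> psdmx M -> \tr M = 1 ->
      exists2 tau : tensmx R n d, Cd n d tau &
        c' * n%:R <= r%:R ->
        schatten1_sym (partial_trace le_dr M - tau)
            <= normF1 (partial_trace le_dr M - tau)
            <= c * (n%:R ^+ 2 / r%:R ^+ 2)].
Proof.
have [K K_ge0 KP] := reflect_bound R d_ge1.
(* The mean of s is I1 / I0 <= 4 n^2 / r^2 by kernel_ratio. The operator can be
   inverted when 2 K I1 <= I0, for instance when 8 K n^2 <= r^2, and the error
   is then at most 2 K I1 / I0. The additional constants ensure c > 0 and
   r >= 2. *)
exists (8 * K + 1), (8 * K + 2); split; rewrite ?ltr_wpDl ?mulr_ge0 //.
move=> [//|n'] r _ le_dr M M_sym M_psd M_tr; set n := n'.+1.
have [x0 x01] : exists x : 'I_n -> R, (sqnorm R n).@[x] = 1 by apply: unit_vector_exists.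
have [le_nr|lt_rn] := leP ((8 * K + 2) * n%:R) r%:R; last first.
  (* below the threshold any point of the convex hull will do *)
  exists (\sum_(j < 1) 1 *: tens_proj d x0); last by [].
  by apply: (@Cd_conv _ _ _ _ (fun=> 1) (fun=> x0)) => //; rewrite big_ord1.
have n1 : 1 <= n%:R :> R by rewrite ler1n.
have r1 : (1 < r)%N.
  by rewrite -(ltr_nat R); nra.
pose e := nat_of_bool (odd r); pose N := r./2.
have rE : r = (2 * N + e)%N by rewrite -[LHS]odd_double_half addnC mul2n.
pose A : R := (n%:R - 1) / 2; pose b : R := n%:R / 2 + e%:R.
have A0 : 0 <= A by rewrite divr_ge0 // subr_ge0.
have b0 : 0 < b by rewrite ltr_pwDl // divr_gt0 // ltr0n.
pose q := jacobi_coef A b N.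
have I1_ge0 : 0 <= jacobi_sq_moment A b N 1 :=
  @kernel_sq_moment1_ge0 R N e q n x0 isT x01.
have I0_gt0 : 0 < jacobi_sq_moment A b N 0 :=
  @kernel_sq_moment0_gt0 R N e q n x0 isT x01 erefl.
have N0 : (0 < N)%N by rewrite /N half_gt0.
have ratio := kernel_ratio (isT : (0 < n)%N) r1 I1_ge0 I0_gt0
  (jacobi_sq_moment_ratio A0 b0 N0 I1_ge0).
have r0 : 0 < r%:R :> R by rewrite ltr0n ltnW.
have nr : 8 * K * (n%:R ^+ 2 / r%:R ^+ 2) <= 1.
  rewrite mulrA ler_pdivrMr ?exprn_gt0 // mul1r.
  have : ((8 * K + 2) * n%:R) ^+ 2 <= r%:R ^+ 2.
    by rewrite lerXn2r ?nnegrE ?mulr_ge0 ?addr_ge0 ?mulr_ge0 // ltW.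
  have K8 : 8 * K <= (8 * K + 2) ^+ 2 by nra.
  rewrite exprMn => /(le_trans _); apply; rewrite ler_wpM2r ?exprn_ge0 //.
have small : 2 * (K * jacobi_sq_moment A b N 1) <= jacobi_sq_moment A b N 0.
  have h : 2 * (K * (jacobi_sq_moment A b N 1 / jacobi_sq_moment A b N 0)) <= 1.
    by have := ler_wpM2l K_ge0 ratio; lra.
  rewrite -[leRHS]mul1r -[jacobi_sq_moment A b N 1](divfK (lt0r_neq0 I0_gt0)) !mulrA.
  by rewrite ler_wpM2r ?(ltW I0_gt0) // -!mulrA.
pose ell := tens_functional M.
have ell_ge0 g : g \is (2 * N + e).-homog -> 0 <= ell (g ^+ 2).
  by rewrite -rE; apply: tens_functional_sq_ge0.
have ell_mass : ell (sqnorm R n ^+ (2 * N + e)) = 1.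
  by rewrite -rE /ell tens_functional_trace.
have le_d : (d <= 2 * N + e)%N by rewrite -rE.
have [I [w [u [w0 w1 u1 est]]]] := kernel_measure d_ge1 le_d (erefl : q 0%N = 1)
  (KP n) small ell_ge0 ell_mass.
exists (\sum_j w j *: tens_proj d (u j)); first exact: Cd_conv.
move=> _; set Delta := _ - _.
pose phi : {linear {mpoly R[n]} -> R^o} := defect (r - d) ell w u.
have phiA i j : phi (word_poly R (index_word i) * word_poly R (index_word j)) = Delta i j.
  pose ij := word_poly R (index_word i) * word_poly R (index_word j).
  transitivity (tens_functional M (sqnorm R n'.+1 ^+ (r - d) * ij)
                  - \sum_k w k * ij.@[u k]) => //.
  rewrite /ij (tens_functional_partial_trace M_sym le_dr) /Delta [RHS]mxE; congr (_ + _).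
  rewrite mxE summxE; congr (- _).
  by apply: eq_bigr => k _; rewrite mxE tens_projE.
pose B := (8 * K + 1) * (n%:R ^+ 2 / r%:R ^+ 2).
have phiB (f : dhomog n R (2 * d)) : `|phi (f : {mpoly R[n]})| <= B * sphere_norm f.
  have := est f; rewrite -rE => h; apply: le_trans h _.
  rewrite ler_wpM2r ?sphere_norm_ge0 //.
  change (2 * (K * jacobi_sq_moment A b N 1 / jacobi_sq_moment A b N 0)
            <= (8 * K + 1) * (n%:R ^+ 2 / r%:R ^+ 2)).
  have := ler_wpM2l K_ge0 ratio.
  have : 0 <= n%:R ^+ 2 / r%:R ^+ 2 :> R by rewrite divr_ge0 ?exprn_ge0 // ltW.
  by lra.
by rewrite (schatten1_le_normF1 phiA phiB) (normF1_le phiA phiB).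
Qed.
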